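(* Let $n \ge 2$ be an integer, $\beta >2 \ln(2\ln(e n))/\ln(n)$, $m\in\mathbb{N}$, $\alpha>0$, and let $A \in \mathbb{C}^{n \times n}$ be diagonalizable with eigendecomposition $A = V \Lambda V^{-1}$ ($\Lambda$ diagonal), where $V$ is $\beta$-normal. Let $\boldsymbol{b} \sim \mathrm{Unif}(\mathbb{S}^{n-1})$ and let $0 < \gamma < \min\{\beta/2,1/4\}$. Then the one-sided Hausdorff distance between $\mathrm{conv}(\Lambda(A))$ and $W(H_{6m+1})$ is bounded by $$\frac{\tilde{d}_H(\mathrm{conv}(\Lambda(A)), W(H_{6m+1}))}{\mathrm{diam}(\mathrm{conv}(\Lambda(A)))} \leq\frac{\frac{6}{m} \ln (n^{2+\alpha} \kappa^2(V))+ \frac{2\ln(e n)}{n^{\beta/2}}}{1 - \frac{2\ln(e n)}{n^{\beta/2}}} + \frac{\pi}{n^\gamma}\tan \frac{2 \pi}{n^\gamma}$$ with probability at least $$1 - \frac{e^2 m}{6 n^{\alpha}} - \frac{e}{n^{\beta/2- \gamma}} - \frac{2}{n^{1/2-\gamma}} - \frac{4}{n^{1/4-\gamma}} .$$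
   Context: $\mathbb{N}$ denotes the positive integers and $[n]=\{1,\dots,n\}$. An invertible matrix $V \in \mathbb{C}^{n \times n}$ is called $\beta$-normal, for $\beta>0$, if its columns have Euclidean norm one and, writing $V = [ \boldsymbol{v}_1 \, \ldots \, \boldsymbol{v}_n]$ and $(V^{-1})^* = [ \boldsymbol{w}_1 \, \ldots \, \boldsymbol{w}_n ]$ in columns, $$\sum_{\ell \in [n] \setminus \{k\} } |\boldsymbol{v}_k^* \boldsymbol{v}_\ell|\, \big(|\boldsymbol{w}_\ell^* \boldsymbol{w}_j| + |\boldsymbol{w}_k^* \boldsymbol{w}_j|\big)\leq n^{-\beta}\|\boldsymbol{w}_j\|_2^2 \quad \text{for all } j,k \in [n].$$ The numerical range of a square matrix $M\in\mathbb{C}^{k\times k}$ is $W(M)=\{\boldsymbol{x}^*M\boldsymbol{x}/\boldsymbol{x}^*\boldsymbol{x} : \boldsymbol{x}\in\mathbb{C}^k\setminus\{0\}\}$. For $A\in\mathbb{C}^{n\times n}$, nonzero $\boldsymbol{b}\in\mathbb{C}^n$ and $k\in\mathbb{N}$, the Krylov subspace is $\mathcal{K}_k(A,\boldsymbol{b})=\mathrm{span}\{\boldsymbol{b},A\boldsymbol{b},\ldots,A^{k-1}\boldsymbol{b}\}$, and $H_k=Q^*AQ$, where the columns of $Q$ form an orthonormal basis of $\mathcal{K}_k(A,\boldsymbol{b})$ (if $\dim\mathcal{K}_k(A,\boldsymbol{b})<k$, then $H_k$ has size $\dim\mathcal{K}_k(A,\boldsymbol{b})$); thus $W(H_k)=\{\boldsymbol{x}^*A\boldsymbol{x}/\boldsymbol{x}^*\boldsymbol{x}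 : \boldsymbol{x}\in\mathcal{K}_k(A,\boldsymbol{b})\setminus\{0\}\}$. $\Lambda(A)$ is the spectrum of $A$, $\mathrm{conv}$ the convex hull, $\mathrm{diam}$ the diameter, $\kappa(V)=\|V\|_2\|V^{-1}\|_2$ (spectral norm). For $S,T\subset\mathbb{C}$, $\tilde{d}_H(S,T)=\sup_{s\in S}\inf_{t\in T}|s-t|$. $\mathbb{S}^{n-1}$ is the complex unit sphere in $\mathbb{C}^n$, with uniform probability measure $\mathrm{Unif}(\mathbb{S}^{n-1})$.
   Formalization: The formal theorem additionally assumes 2π/n^γ < π/2, i.e. n^γ > 4, so that the tangent is that of an acute angle; for n^γ slightly below 4 the stated right-hand side is negative and the claim fails. *)

(* Defs.v *)
From mathcomp Require Export all_boot all_order all_algebra.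
From mathcomp Require Export complex.
From mathcomp Require Export all_classical all_reals all_analysis.

Set Implicit Arguments.
Unset Strict Implicit.
Unset Printing Implicit Defensive.

Import Order.TTheory GRing.Theory Num.Theory.

Local Open Scope classical_set_scope.
Local Open Scope ring_scope.
Local Open Scope sesquilinear_scope.

Section Definitions.
Variable R : realType.
Local Notation C := R[i].

Definition cabs (z : C) : R := Normc.normc z.

(** x^* y *)
Definition cdot n (x y : 'cV[C]_n) : C := (x^t* *m y) 0 0.

Definition norm2 n (x : 'cV[C]_n) : R :=
  Num.sqrt (\sum_(i < n) cabs (x i 0) ^+ 2).

Definition csphere n : set 'cV[C]_n := [set x | norm2 x = 1].

Definition spectral_norm m n (M : 'M[C]_(m, n)) : R :=
  sup [set norm2 (M *m x) | x in @csphere n].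

Definition cond2 n (V : 'M[C]_n) : R := spectral_norm V * spectral_norm (invmx V).

Definition beta_normal n (beta : R) (V : 'M[C]_n) : Prop :=
  let v k := col k V in
  let w k := col k ((invmx V)^t*) in
  [/\ 0 < beta,
      V \in unitmx,
      forall k, norm2 (v k) = 1 &
      forall j k,
        \sum_(l < n | l != k) cabs (cdot (v k) (v l)) *
            (cabs (cdot (w l) (w j)) + cabs (cdot (w k) (w j)))
          <= n%:R `^ (- beta) * norm2 (w j) ^+ 2].

Definition numerical_range k (M : 'M[C]_k) : set C :=
  [set cdot x (M *m x) / cdot x x | x in [set x : 'cV[C]_k | x != 0]].

Definition krylov n (k : nat) (A : 'M[C]_n) (b : 'cV[C]_n) : set 'cV[C]_n :=
  [set x | exists c : 'I_k -> C, x = \sum_(i < k) c i *: (A ^+ i *m b)].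

Definition orthonormal_basis n d (Q : 'M[C]_(n, d)) (S : set 'cV[C]_n) : Prop :=
  Q^t* *m Q = 1%:M /\ range (fun y : 'cV[C]_d => Q *m y) = S.

Definition spectrum n (A : 'M[C]_n) : set C := [set a | eigenvalue A a].

Definition convex_hull (S : set C) : set C :=
  [set z | exists (p : nat) (t : 'I_p -> R) (s : 'I_p -> C),
    [/\ forall i, 0 <= t i, \sum_(i < p) t i = 1, forall i, S (s i) &
        z = \sum_(i < p) (t i)%:C%C * s i]].

Definition diam (S : set C) : R :=
  sup [set r | exists s t, [/\ S s, S t & r = cabs (s - t)]].

(** sup over S of the distance to T; real-valued, hence meaningful for
    nonempty S and T with S bounded. *)
Definition one_sided_hausdorff (S T : set C) : R :=
  sup [set inf [set cabs (s - t) | t in T] | s in S].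

(** The Borel sigma-algebra of C^n = R^(2n), generated by the real and
    imaginary parts of the coordinates. *)
Definition borel_cV n : set (set 'cV[C]_n) :=
  <<s [set E | exists (i : 'I_n) (B : set R), measurable B /\
         (E = [set x : 'cV[C]_n | B (complex.Re (x i 0))] \/ E = [set x : 'cV[C]_n | B (complex.Im (x i 0))])] >>.

(** b ~ Unif(S^(n-1)): the law of b is the (unique) unitarily invariant Borel
    probability measure on the complex unit sphere. *)
Definition unif_sphere d (Omega : measurableType d) (P : probability Omega R)
    n (b : Omega -> 'cV[C]_n) : Prop :=
  [/\ forall E, borel_cV E -> measurable (b @^-1` E),
      P (b @^-1` @csphere n) = 1%E &
      forall U : 'M[C]_n, U \is unitarymx -> forall E, borel_cV E ->
        P [set w | E (U *m b w)] = P (b @^-1` E)].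

(** As in the library's [{ae P, _}], measurability of the event itself is not
    part of the notion: the event contains a measurable set of probability at
    least p. *)
Definition with_prob_ge d (Omega : measurableType d) (P : probability Omega R)
    (p : R) (event : set Omega) : Prop :=
  exists E : set Omega, [/\ measurable E, E `<=` event & (p%:E <= P E)%E].

End Definitions.

(* Main.v *)
(** Taking j = k in the definition of beta-normality and dividing by the squared
    norm of w_k gives sum_{l <> k} |v_k^* v_l| <= delta := n^{-beta}, so the Gram
    matrix of V is a perturbation of the identity of norm at most delta (Schur
    test).  Hence for x = V y the Rayleigh quotient of A at x differs from the
    weighted mean of the eigenvalues with weights |y_l|^2 by a controlled amount.

    Fix a direction u and let lam_k maximize Re (u lam).  The Krylov subspace
    contains V y with y_l = p(lam_l) c_l, c = V^{-1} b, deg p <= 6m.  Choosing for p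
    a truncated exponential peaked at lam_k damps the components whose eigenvalues
    lie far below lam_k in the direction u, provided that |c_k| is not extremely
    small.  So every supporting half-plane of the hull of the spectrum is nearly
    reached by the numerical range, whose convexity (Toeplitz-Hausdorff) turns this
    into a bound on the Hausdorff distance.

    With high probability all |c_k| are at least an inverse power of n: b is
    invariant under the rotations that multiply its component along a vector g by a
    phase, and for separated phases these move w^* b by more than the width of the
    slab |w^* b| < t, which gives disjoint events of equal probability.  Already the
    term e^2 m / (6 n^alpha) of the failure probability pays for this; the term
    4 / n^{1/4 - gamma} merely forces n >= 256, and the other terms, like the tangent
    term of the bound, enter only through their sign. *)

Require Import Defs.
From HB Require Import structures.
From mathcomp Require Import measurable_realfun ring lra.

Set Implicit Arguments.
Unset Strict Implicit.
Unset Printing Implicit Defensive.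

Import Order.TTheory GRing.Theory Num.Theory.

Local Open Scope classical_set_scope.
Local Open Scope ring_scope.
Local Open Scope sesquilinear_scope.

(** * Complex numbers and vectors *)

Section ComplexModulus.
Variable R : realType.
Implicit Types (z w : R[i]) (r : R).
Local Notation Re := complex.Re.
Local Notation Im := complex.Im.

Lemma ReD z w : Re (z + w) = Re z + Re w. Proof. by case: z; case: w. Qed.

Lemma ReN z : Re (- z) = - Re z. Proof. by case: z. Qed.

Lemma ReB z w : Re (z - w) = Re z - Re w. Proof. by rewrite ReD ReN. Qed.

Lemma ImD z w : Im (z + w) = Im z + Im w. Proof. by case: z; case: w. Qed.

Lemma ReM z w : Re (z * w) = Re z * Re w - Im z * Im w.
Proof. by case: z; case: w. Qed.

Lemma ImM z w : Im (z * w) = Re z * Im w + Im z * Re w.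
Proof. by case: z; case: w. Qed.

Lemma Re_conj z : Re z^* = Re z. Proof. by case: z. Qed.

Lemma Im_conj z : Im z^* = - Im z. Proof. by case: z. Qed.

Lemma ReMreal r z : Re (r%:C%C * z) = r * Re z.
Proof. by rewrite ReM /= mul0r subr0. Qed.

Lemma Re_sum (I : Type) (s : seq I) (p : pred I) (f : I -> R[i]) :
  Re (\sum_(i <- s | p i) f i) = \sum_(i <- s | p i) Re (f i).
Proof. by apply: big_morph => //; exact: ReD. Qed.

Lemma Im_sum (I : Type) (s : seq I) (p : pred I) (f : I -> R[i]) :
  Im (\sum_(i <- s | p i) f i) = \sum_(i <- s | p i) Im (f i).
Proof. by apply: big_morph => //; exact: ImD. Qed.

Lemma cabs_norm z : (cabs z)%:C%C = `|z|.
Proof. by case: z => a b; rewrite normc_def. Qed.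

Lemma cabsE z : cabs z = Re `|z|. Proof. by rewrite -cabs_norm. Qed.

Lemma cabs_ge0 z : 0 <= cabs z.
Proof. by rewrite -ler0c cabs_norm. Qed.

Lemma cabsM z w : cabs (z * w) = cabs z * cabs w.
Proof. exact: Normc.normcM. Qed.

Lemma cabsV z : cabs z^-1 = (cabs z)^-1.
Proof. exact: Normc.normcV. Qed.

Lemma cabsN z : cabs (- z) = cabs z.
Proof. by rewrite !cabsE normrN. Qed.

Lemma cabs_conj z : cabs z^* = cabs z.
Proof. by rewrite !cabsE norm_conjC. Qed.

Lemma ler_cabsD z w : cabs (z + w) <= cabs z + cabs w.
Proof. exact: (@le_normcD R z w). Qed.

Lemma ler_cabsB z w : cabs (z - w) <= cabs z + cabs w.
Proof. by rewrite -(cabsN w) ler_cabsD. Qed.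

Lemma lerB_cabsD z w : cabs z - cabs w <= cabs (z + w).
Proof. by rewrite lerBlDr -{1}(addrK w z); apply: ler_cabsB. Qed.

Lemma cabs0 : cabs (0 : R[i]) = 0. Proof. exact: Normc.normc0. Qed.

Lemma cabs1 : cabs (1 : R[i]) = 1. Proof. exact: Normc.normc1. Qed.

Lemma cabs_eq0 z : (cabs z == 0) = (z == 0).
Proof.
by apply/eqP/eqP => [/Normc.eq0_normc//|->]; rewrite cabs0.
Qed.

Lemma cabs_real r : cabs r%:C%C = `|r|.
Proof. by rewrite /cabs /= expr0n /= addr0 sqrtr_sqr. Qed.

Lemma ler_cabs_sum (I : Type) (s : seq I) (p : pred I) (f : I -> R[i]) :
  cabs (\sum_(i <- s | p i) f i) <= \sum_(i <- s | p i) cabs (f i).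
Proof.
elim/big_rec2: _ => [|i y x _ xy]; first by rewrite cabs0.
by rewrite (le_trans (ler_cabsD _ _))// lerD2l.
Qed.

Lemma cabs_sqr z : cabs z ^+ 2 = Re z ^+ 2 + Im z ^+ 2.
Proof. by case: z => a b; rewrite /cabs /= sqr_sqrtr// addr_ge0// sqr_ge0. Qed.

Lemma ler_norm_Re z : `|Re z| <= cabs z.
Proof. by rewrite -lecR cabs_norm; exact: normc_ge_Re. Qed.

Lemma Re_ge_cabs z : - cabs z <= Re z.
Proof. by have := ler_norm_Re z; rewrite ler_norml => /andP[]. Qed.

Lemma Re_le_cabs z : Re z <= cabs z.
Proof. by have := ler_norm_Re z; rewrite ler_norml => /andP[]. Qed.

Lemma conjCM_sqr z : z^* * z = (cabs z ^+ 2)%:C%C.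
Proof. by rewrite mulrC -normCK -cabs_norm rmorphXn. Qed.

Lemma conjC_real r : (r%:C%C)^* = r%:C%C.
Proof. exact: conjc_real. Qed.

End ComplexModulus.

Section HermitianProduct.
Variable R : realType.
Local Notation C := R[i].

Lemma norm2_ge0 n (x : 'cV[C]_n) : 0 <= norm2 x.
Proof. exact: sqrtr_ge0. Qed.

Lemma norm2_sqr n (x : 'cV[C]_n) : norm2 x ^+ 2 = \sum_(i < n) cabs (x i 0) ^+ 2.
Proof. by rewrite sqr_sqrtr// sumr_ge0// => i _; rewrite sqr_ge0. Qed.

Lemma cdotE n (x y : 'cV[C]_n) : cdot x y = \sum_i (x i 0)^* * y i 0.
Proof. by rewrite /cdot mxE; apply: eq_bigr => i _; rewrite !mxE. Qed.

Lemma cdotDr n (x y z : 'cV[C]_n) : cdot x (y + z) = cdot x y + cdot x z.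
Proof. by rewrite /cdot mulmxDr mxE. Qed.

Lemma cdotZr n a (x y : 'cV[C]_n) : cdot x (a *: y) = a * cdot x y.
Proof. by rewrite /cdot -scalemxAr mxE. Qed.

Lemma cdot_conj n (x y : 'cV[C]_n) : (cdot x y)^* = cdot y x.
Proof.
rewrite !cdotE rmorph_sum; apply: eq_bigr => i _.
by rewrite rmorphM /= conjCK mulrC.
Qed.

Lemma cdotDl n (x y z : 'cV[C]_n) : cdot (x + y) z = cdot x z + cdot y z.
Proof. by rewrite -cdot_conj cdotDr rmorphD /= !cdot_conj. Qed.

Lemma cdotZl n a (x y : 'cV[C]_n) : cdot (a *: x) y = a^* * cdot x y.
Proof. by rewrite -cdot_conj cdotZr rmorphM /= cdot_conj. Qed.

Lemma cdotxx n (x : 'cV[C]_n) : cdot x x = (norm2 x ^+ 2)%:C%C.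
Proof.
rewrite cdotE norm2_sqr rmorph_sum; apply: eq_bigr => i _.
exact: conjCM_sqr.
Qed.

Lemma cdot_mulmxr m n (M : 'M[C]_(m, n)) x y :
  cdot x (M *m y) = cdot (M^t* *m x) y.
Proof.
rewrite /cdot trmx_mul map_mxM /= -mulmxA map_trmx -map_mx_comp trmxK.
congr ((_ *m (_ *m _)) 0 0); apply/matrixP => i j; rewrite !mxE /=.
by rewrite conjCK.
Qed.

Lemma cdot_mulmxl m n (M : 'M[C]_(m, n)) x y :
  cdot (M *m x) y = cdot x (M^t* *m y).
Proof. by rewrite -cdot_conj cdot_mulmxr cdot_conj. Qed.

Lemma norm2_eq0 n (x : 'cV[C]_n) : (norm2 x == 0) = (x == 0).
Proof.
apply/eqP/eqP => [x0|->]; last first.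
  by rewrite /norm2 big1 ?sqrtr0// => i _; rewrite mxE cabs0 expr0n.
have /eqP : norm2 x ^+ 2 = 0 by rewrite x0 expr0n.
rewrite norm2_sqr psumr_eq0; last by move=> i _; exact: sqr_ge0.
move=> /allP h; apply/matrixP => i j; rewrite mxE (ord1 j).
have := h i (mem_index_enum i); rewrite sqrf_eq0 cabs_eq0 => /eqP.
by [].
Qed.

Lemma norm2_gt0 n (x : 'cV[C]_n) : (0 < norm2 x) = (x != 0).
Proof. by rewrite lt0r norm2_eq0 norm2_ge0 andbT. Qed.

Lemma cdotxx_eq0 n (x : 'cV[C]_n) : (cdot x x == 0) = (x == 0).
Proof.
rewrite cdotxx -norm2_eq0 -(sqrf_eq0 (norm2 x)); apply/eqP/eqP => [[]//|->//].
Qed.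

Lemma norm2Z n a (x : 'cV[C]_n) : norm2 (a *: x) = cabs a * norm2 x.
Proof.
apply/eqP; rewrite -(eqrXn2 (n := 2))// ?mulr_ge0 ?norm2_ge0 ?cabs_ge0//.
rewrite exprMn !norm2_sqr mulr_sumr; apply/eqP/eq_bigr => i _.
by rewrite mxE cabsM exprMn.
Qed.

(** Termwise $2ac \le a^2 + c^2$; this form stands in for Cauchy-Schwarz below. *)
Lemma cabs_cdot_le n (x y : 'cV[C]_n) :
  cabs (cdot x y) <= (norm2 x ^+ 2 + norm2 y ^+ 2) / 2.
Proof.
rewrite cdotE !norm2_sqr (le_trans (ler_cabs_sum _ _ _))//.
rewrite -big_split mulr_suml ler_sum// => i _ /=.
rewrite cabsM cabs_conj; set a := cabs _; set c := cabs _.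
by have := sqr_ge0 (a - c); nra.
Qed.

End HermitianProduct.

(** * The truncated exponential *)

Section TruncatedExponential.

Definition exp_trunc (F : numFieldType) (K : nat) (z : F) : F :=
  \sum_(i < K.+1) z ^+ i / i`!%:R.

(** The terms of total degree above [K] in the product of two truncated series, i.e. the failure of
    the functional equation of the exponential. *)
Definition exp_trunc_defect (F : numFieldType) (K : nat) (z w : F) : F :=
  \sum_(i < K.+1) \sum_(j < K.+1 | (K < i + j)%N)
    (z ^+ i / i`!%:R) * (w ^+ j / j`!%:R).

Lemma sum_triangle (V : nmodType) (K : nat) (f : nat -> nat -> V) :
  \sum_(i < K.+1) \sum_(j < K.+1 | (i + j <= K)%N) f i j =
  \sum_(k < K.+1) \sum_(i < k.+1) f i (k - i)%N.
Proof.
transitivity (\sum_(k < K.+1) \sum_(i < K.+1 | (i < k.+1)%N) f i (k - i)%N);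
  last first.
  apply: eq_bigr => k _.
  by rewrite (big_ord_widen K.+1 (fun i => f i (k - i)%N)).
rewrite [RHS](exchange_big_dep xpredT)//=; apply: eq_bigr => i _.
rewrite -(big_mkord (fun j => (i + j <= K)%N) (f i)).
rewrite -(big_mkord (fun k => (i < k.+1)%N) (fun k => f i (k - i)%N)).
have iK : (i <= K.+1)%N by rewrite ltnW.
rewrite [RHS](big_cat_nat (n := i))//= [X in _ = X + _]big_nat_cond.
rewrite [X in _ = X + _]big1 ?add0r; last first.
  by move=> k /andP[/andP[_ ki]]; rewrite ltnS leqNgt ki.
rewrite [RHS](big_addn 0 K.+1 i) /=.
rewrite (big_cat_nat (n := K.+1 - i))//= ?leq_subr//.
rewrite [X in _ + X]big_nat_cond [X in _ + X]big1 ?addr0; last first.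
  by move=> k /andP[/andP[]]; rewrite leq_subLR ltnNge => /negbTE ->.
rewrite big_nat_cond [RHS]big_nat_cond; apply: eq_big => k; last by rewrite addnK.
rewrite !leq0n /= ltnS leq_addl andbT ltn_subRL ltnS.
by case: (i + k <= K)%N.
Qed.

(** By the binomial theorem, the terms of total degree $k \le K$ add up to $(z+w)^k/k!$. *)
Lemma exp_truncM (F : numFieldType) K (z w : F) :
  exp_trunc K z * exp_trunc K w = exp_trunc K (z + w) + exp_trunc_defect K z w.
Proof.
rewrite /exp_trunc big_distrlr /=.
under eq_bigr => i _ do rewrite (bigID (fun j : 'I_K.+1 => i + j <= K)%N) /=.
rewrite big_split /=; congr (_ + _).
  rewrite (sum_triangle K (fun i j => z ^+ i / i`!%:R * (w ^+ j / j`!%:R))).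
  apply: eq_bigr => k _; rewrite addrC exprDn mulr_suml; apply: eq_bigr => i _.
  have ik : (i <= k)%N by rewrite -ltnS.
  have h := bin_fact ik.
  rewrite -h !natrM -mulr_natl.
  have h0 m : (m`!%:R : F) != 0 by rewrite pnatr_eq0 -lt0n fact_gt0.
  have hb : ('C(k, i)%:R : F) != 0 by rewrite pnatr_eq0 -lt0n bin_gt0.
  by field; rewrite !h0 hb.
by apply: eq_bigr => i _; apply: eq_bigl => j; rewrite -ltnNge.
Qed.

Lemma ler_norm_defect (F : numFieldType) K (z w : F) :
  `|exp_trunc_defect K z w| <= exp_trunc_defect K `|z| `|w|.
Proof.
rewrite (le_trans (ler_norm_sum _ _ _))// ler_sum// => i _.
rewrite (le_trans (ler_norm_sum _ _ _))// ler_sum// => j _.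
by rewrite !normrM !normrX !normrV ?unitfE ?pnatr_eq0 -?lt0n ?fact_gt0// !normr_nat.
Qed.

Variable R : realType.
Implicit Types (x y : R).

Lemma exp_trunc_real K x : exp_trunc K x%:C%C = (exp_trunc K x)%:C%C :> R[i].
Proof.
rewrite /exp_trunc rmorph_sum /=; apply: eq_bigr => i _.
by rewrite rmorphM /= rmorphXn /= fmorphV rmorph_nat.
Qed.

Lemma exp_truncE K x : exp_trunc K x = series (exp_coeff x) K.+1.
Proof. by rewrite /series /= big_mkord; apply: eq_bigr. Qed.

Lemma exp_trunc_le_expR K x : 0 <= x -> exp_trunc K x <= expR x.
Proof.
move=> x0; rewrite exp_truncE; apply: nondecreasing_cvgn_le.
  apply/nondecreasing_seqP => k; rewrite /series /= big_nat_recr//= lerDl.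
  exact: exp_coeff_ge0.
exact: is_cvg_series_exp_coeff.
Qed.

(** A Chernoff-type bound: for $i > K$ the factor $e^{i-K}$ is at least 1, so $x^i/i! \le e^{-K}
    (ex)^i/i!$. *)
Lemma exp_tail_partial K N x : (K <= N)%N -> 0 <= x ->
  exp_trunc N x - exp_trunc K x <= expR (expR 1 * x - K%:R).
Proof.
move=> KN x0.
have e1 : 1 <= expR 1 :> R by rewrite -expR0 ler_expR.
suff : exp_trunc N x - exp_trunc K x <= expR (- K%:R) * exp_trunc N (expR 1 * x).
  move=> /le_trans; apply; rewrite addrC expRD ler_wpM2l ?expR_ge0//.
  by rewrite exp_trunc_le_expR// mulr_ge0 ?expR_ge0.
rewrite /exp_trunc -(big_mkord xpredT (fun i => x ^+ i / i`!%:R)).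
rewrite -(big_mkord xpredT (fun i => x ^+ i / i`!%:R)).
rewrite -(big_mkord xpredT (fun i => (expR 1 * x) ^+ i / i`!%:R)).
rewrite (big_cat_nat (m := 0) (n := K.+1) (p := N.+1))//= [X in X - _]addrC addrK.
rewrite (big_cat_nat (m := 0) (n := K.+1) (p := N.+1))//= mulrDr.
rewrite -[leLHS]add0r lerD//.
  rewrite mulr_ge0 ?expR_ge0// sumr_ge0// => i _.
  by rewrite divr_ge0// exprn_ge0// mulr_ge0 ?expR_ge0.
rewrite mulr_sumr !big_nat ler_sum// => i /andP[Ki _].
rewrite mulrA ler_wpM2r ?invr_ge0// exprMn mulrA.
rewrite ler_peMl ?exprn_ge0// -expRM_natl mulr1 -expRD -[leLHS]expR0 ler_expR.
by rewrite addrC subr_ge0 ler_nat ltnW.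
Qed.

Lemma exp_tail K x : 0 <= x -> expR x - exp_trunc K x <= expR (expR 1 * x - K%:R).
Proof.
move=> x0; rewrite lerBlDl.
apply: limr_le; first exact: is_cvg_series_exp_coeff.
near=> N; have KN : (K < N)%N by near: N; exact: nbhs_infty_gt.
rewrite -(ltn_predK KN) -exp_truncE -lerBlDl exp_tail_partial//.
by rewrite -ltnS (ltn_predK KN).
Unshelve. all: by end_near. Qed.

(** Since $x^i + |x|^i \ge 0$, the partial sums of the series of $e^x + e^{|x|}$ increase and stay
    below their limit. *)
Lemma exp_trunc_dist K x :
  exp_trunc K x <= expR x + (expR `|x| - exp_trunc K `|x|).
Proof.
rewrite addrA lerBrDr !exp_truncE -[leLHS]/((series _ + series _) K.+1).
rewrite -seriesD -limD; [|exact: is_cvg_series_exp_coeff..].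
rewrite -[X in limn X]seriesD; apply: nondecreasing_cvgn_le.
  apply/nondecreasing_seqP => k; rewrite /series /= big_nat_recr//= lerDl.
  rewrite !fctE /exp_coeff -mulrDl divr_ge0// -lerBlDr sub0r -normrX.
  by rewrite lerNl -normrN ler_norm.
rewrite seriesD; apply: is_cvgD; exact: is_cvg_series_exp_coeff.
Qed.

(** With $T$ the truncation, $|T(z)|^2 = T(\bar z) T(z)$ equals $T(2 \mathrm{Re}\, z)$ plus a
    defect. The first summand exceeds $e^{2 \mathrm{Re}\, z}$ by at most an exponential tail. The
    defect is at most its value at the moduli, $T(|z|)^2 - T(2|z|) \le e^{2|z|} - T(2|z|)$, which is
    another tail. *)
Lemma exp_trunc_sqr_le K (z : R[i]) :
  cabs (exp_trunc K z) ^+ 2 <=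
  expR (2 * complex.Re z) + 2 * expR (expR 1 * (2 * cabs z) - K%:R).
Proof.
set x := cabs z; have x0 : 0 <= x := cabs_ge0 z.
have -> : cabs (exp_trunc K z) ^+ 2 =
    complex.Re (exp_trunc K z^* * exp_trunc K z).
  suff -> : exp_trunc K z^* = (exp_trunc K z)^* by rewrite conjCM_sqr.
  rewrite /exp_trunc rmorph_sum; apply: eq_bigr => i _ /=.
  by rewrite rmorphM rmorphXn /= fmorphV rmorph_nat.
have -> : exp_trunc K z^* * exp_trunc K z =
    (exp_trunc K (2 * complex.Re z))%:C%C + exp_trunc_defect K z^* z.
  rewrite exp_truncM -exp_trunc_real; congr (exp_trunc K _ + _).
  by rewrite addrC addcJ rmorphM rmorph_nat.
rewrite ReD /= [2 * expR (_ - _)]mulr_natl [in leRHS]mulr2n addrA; apply: lerD.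
  rewrite (le_trans (exp_trunc_dist _ _))// lerD2l.
  set y := `|_|; have yx : y <= 2 * x.
    by rewrite /y normrM ger0_norm// ler_wpM2l// ler_norm_Re.
  rewrite (le_trans (exp_tail K (normr_ge0 _)))// ler_expR lerD2r.
  by rewrite ler_wpM2l ?expR_ge0.
rewrite (le_trans (Re_le_cabs _))//.
suff h : cabs (exp_trunc_defect K z^* z) <= exp_trunc K x * exp_trunc K x - exp_trunc K (2 * x).
  rewrite (le_trans h)// (le_trans _ (exp_tail K (x := 2 * x) _)) ?mulr_ge0// lerD2r.
  rewrite mulr_natl mulr2n expRD ler_pM ?exp_trunc_le_expR//.
    by apply: sumr_ge0 => i _; rewrite divr_ge0// exprn_ge0.
  by apply: sumr_ge0 => i _; rewrite divr_ge0// exprn_ge0.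
rewrite -lecR cabs_norm (le_trans (ler_norm_defect _ _ _))//.
rewrite rmorphB rmorphM /= -!exp_trunc_real exp_truncM -!cabs_norm cabs_conj -/x.
by rewrite mulr_natl rmorphMn /= mulr2n addrAC subrr add0r.
Qed.

End TruncatedExponential.

(** * The numerical range *)

Section NumericalRange.
Variable R : realType.
Local Notation C := R[i].
Local Notation Re := complex.Re.

(** The imaginary part equals that of $s(p - \bar q)$, so [s] only has to rotate $p - \bar q$ to the
    nonnegative real axis. *)
Lemma exists_phase_real (p q : C) :
  exists2 s : C, cabs s = 1 & complex.Im (s * p + s^* * q) = 0.
Proof.
pose d := p - q^*; have [d0|d0] := eqVneq d 0.
  exists 1; first exact: cabs1.
  have -> : p = q^* by apply/eqP; rewrite -subr_eq0; apply/eqP.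
  by rewrite rmorph1 !mul1r ImD Im_conj addNr.
exists (d^* * ((cabs d)^-1)%:C%C).
  by rewrite cabsM cabs_conj cabs_real ger0_norm ?invr_ge0 ?cabs_ge0// divff// cabs_eq0.
set r := (_^-1)%:C%C; set s := _ * r.
have : s * d = (cabs d)%:C%C.
  rewrite /s mulrAC conjCM_sqr /r -rmorphM /= expr2 -mulrA divff ?mulr1//.
  by rewrite cabs_eq0.
rewrite /d mulrBr => /(congr1 (@complex.Im R)) /=.
rewrite ImD -mulN1r => h; rewrite ImD -[RHS]h; congr (_ + _).
by rewrite mulN1r -(opprK (complex.Im (s^* * q))) -Im_conj rmorphM /= conjCK; case: (s * q^*).
Qed.

(** Toeplitz-Hausdorff. The form [g] moves the target point to 0 and makes the values at [x] and [y]
    real, of opposite signs. A phase on [y] makes the cross term real too, so along the segment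
    between [x] and the rotated [y] the form is a real quadratic polynomial with a zero in
    $[0,1]$. *)
Lemma numerical_range_convex k (M : 'M[C]_k) (z1 z2 : C) (t : R) :
  numerical_range M z1 -> numerical_range M z2 -> 0 <= t <= 1 ->
  numerical_range M (t%:C%C * z1 + (1 - t)%:C%C * z2).
Proof.
move=> [x /= x0 xz1] [y /= y0 yz2] /andP[t0 t1].
have [z12|z12] := eqVneq z1 z2.
  exists x => //=; rewrite xz1 -z12 -mulrDl -rmorphD /= addrC subrK.
  by rewrite mul1r.
set s := _ + _; pose dl := z1 - z2; have dl0 : dl != 0 by rewrite subr_eq0.
have ux : cdot x x != 0 by rewrite cdotxx_eq0.
have uy : cdot y y != 0 by rewrite cdotxx_eq0.
pose g u v := (cdot u (M *m v) - s * cdot u v) / dl.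
have gx : g x x = ((1 - t) * norm2 x ^+ 2)%:C%C.
  have -> : g x x = (1 - t)%:C%C * cdot x x.
    rewrite /g -[cdot x (M *m x)](divfK ux) xz1 /s rmorphB rmorph1 /=.
    by rewrite /dl in dl0 *; field.
  by rewrite cdotxx -rmorphM.
have gy : g y y = (- (t * norm2 y ^+ 2))%:C%C.
  have -> : g y y = (- t)%:C%C * cdot y y.
    rewrite /g -[cdot y (M *m y)](divfK uy) yz2 /s rmorphB rmorph1 rmorphN /=.
    by rewrite /dl in dl0 *; field.
  by rewrite cdotxx -rmorphM /= mulNr.
have [sg sg1 im0] := exists_phase_real (g x y) (g y x).
pose rho := Re (sg * g x y + sg^* * g y x).
have rhoE : sg * g x y + sg^* * g y x = rho%:C%C.
  by rewrite /rho; move: im0; case: (_ + _) => a b /= ->.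
pose P := ((1 - t) * norm2 x ^+ 2) *: 'X^2 + rho *: ('X * (1 - 'X))
          - (t * norm2 y ^+ 2) *: (1 - 'X) ^+ 2.
have PE a : P.[a] = (1 - t) * norm2 x ^+ 2 * a ^+ 2 + rho * (a * (1 - a))
    - t * norm2 y ^+ 2 * (1 - a) ^+ 2 by rewrite /P !hornerE.
have [||a /andP[a0 a1] /rootP] := @poly_ivt _ P 0 1.
- exact: ler01.
- rewrite !PE; apply/andP; split.
    rewrite expr0n/= mulr0 mul0r mulr0 !addr0 sub0r subr0 expr1n mulr1 oppr_le0.
    by rewrite mulr_ge0// sqr_ge0.
  rewrite subrr expr0n /= !mulr0 subr0 addr0 expr1n mulr1.
  by rewrite mulr_ge0 ?sqr_ge0// subr_ge0.
rewrite PE => Pa.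
pose c := (1 - a)%:C%C * sg; pose u := a%:C%C *: x + c *: y.
have guu : g u u = 0.
  transitivity (a%:C%C ^+ 2 * g x x + a%:C%C * (1 - a)%:C%C * (sg * g x y + sg^* * g y x)
      + (1 - a)%:C%C ^+ 2 * (sg^* * sg) * g y y).
    rewrite /g /u mulmxDr -!scalemxAr !(cdotDl, cdotDr, cdotZl, cdotZr).
    by rewrite /c rmorphM /= !conjC_real; field.
  rewrite conjCM_sqr sg1 expr1n mulr1 rhoE gx gy -[RHS](rmorph0 (real_complex R)) -Pa.
  by rewrite !(rmorphD, rmorphB, rmorphN, rmorphM, rmorphXn, rmorph1) /=; ring.
have sg0 : sg != 0 by rewrite -cabs_eq0 sg1 oner_eq0.
(* If [u] vanished with [a] nonzero, then [x] would be a multiple of [y] and the two given values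
   would coincide. *)
have u0 : u != 0.
  apply/eqP; rewrite /u; have [az|an0] := eqVneq a 0.
    rewrite /c az rmorph0 scale0r add0r subr0 rmorph1 mul1r => /eqP.
    by rewrite scaler_eq0 (negbTE sg0) (negbTE y0).
  have aC0 : a%:C%C != 0 :> C by rewrite -cabs_eq0 cabs_real normr_eq0.
  move/eqP; rewrite addr_eq0 -scaleNr => /eqP /(congr1 (fun v => a%:C%C^-1 *: v)).
  rewrite !scalerA mulVf// scale1r; set e := _ * _ => xe.
  have e0 : e != 0 by apply: contraNneq x0 => e0; rewrite xe e0 scale0r.
  move: z12; rewrite -xz1 -yz2 xe -scalemxAr !(cdotZl, cdotZr) => /eqP; apply.
  by field; rewrite uy e0 conjC_eq0.
exists u => //; move/eqP: guu.
rewrite mulf_eq0 invr_eq0 (negbTE dl0) orbF subr_eq0 => /eqP ->.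
by rewrite mulfK// cdotxx_eq0.
Qed.

(** Were the distance [r] larger than [rho], take a nearly closest point [z0] and a point [z] of [W]
    far out in the direction from [z0] to [s]. A small move from [z0] towards [z] stays in [W] and
    comes closer to [s] than [r]. Near-minimizers are used because [W] need not be closed. *)
Lemma inf_dist_le_support (W : set C) (s : C) (rho D : R) :
  W !=set0 ->
  (forall z1 z2 t, W z1 -> W z2 -> 0 <= t <= 1 ->
     W (t%:C%C * z1 + (1 - t)%:C%C * z2)) ->
  (forall z, W z -> cabs z <= D) -> 0 <= rho ->
  (forall u : C, cabs u = 1 -> exists2 z, W z & - rho <= Re (u * (z - s))) ->
  inf [set cabs (s - t) | t in W] <= rho.
Proof.
move=> [w0 Ww0] Wconv WD rho0 Wsupp; set S := [set _ | _ in _].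
have Slb : lbound S 0 by move=> _ [t _ <-]; exact: cabs_ge0.
have Sinf : has_inf S by split; [exists (cabs (s - w0)), w0|exists 0].
set r := inf S; have r0 : 0 <= r by apply: lb_le_inf => //; exact: Sinf.1.
have rle t : W t -> r <= cabs (s - t).
  by move=> Wt; apply: ge_inf; [exact: Sinf.2|exists t].
rewrite leNgt; apply/negP => rho_r.
pose g := r - rho; have g0 : 0 < g by rewrite subr_gt0.
pose B := 2 * D + cabs s + 1.
have D0 : 0 <= D := le_trans (cabs_ge0 _) (WD _ Ww0).
have B0 : 0 < B by rewrite /B; have := cabs_ge0 s; lra.
have rB : r <= B.
  rewrite (le_trans (rle _ Ww0))// (le_trans (ler_cabsB _ _))// /B.
  by have := WD _ Ww0; lra.
have gr : g <= r by rewrite /g gerBl.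
(* The excess $(rg/B)^2$ is the gain in squared distance guaranteed by the step length $l = rg/B^2$
   below: $2lrg - l^2B^2 = (rg/B)^2$. *)
pose r' := Num.sqrt (r ^+ 2 + (r * g / B) ^+ 2).
have rr' : r < r'.
  rewrite -(ltr_pXn2r (n := 2))// ?nnegrE ?sqrtr_ge0// sqr_sqrtr ?addr_ge0 ?sqr_ge0//.
  by rewrite ltrDl exprn_gt0// divr_gt0// mulr_gt0// (le_lt_trans rho0).
have [_ [z0 Wz0 <-]] := inf_adherent (eps := r' - r) (ltac:(by rewrite subr_gt0)) Sinf.
rewrite -/r [r + _]addrC subrK; set a := cabs _ => ar'.
have ra : r <= a := rle _ Wz0.
have a0 : 0 < a by rewrite (lt_le_trans _ ra)// (le_lt_trans rho0).
pose u := (s - z0)^* * (a^-1)%:C%C.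
have u1 : cabs u = 1.
  by rewrite cabsM cabs_conj cabs_real gtr0_norm ?invr_gt0// divff// gt_eqF.
have [z Wz supp] := Wsupp _ u1.
pose h := z - z0.
have hB : cabs h <= B.
  rewrite (le_trans (ler_cabsB _ _))// /B.
  by have := WD _ Wz; have := WD _ Wz0; have := cabs_ge0 s; lra.
have Reuh : a - rho <= Re (u * h).
  have -> : u * h = u * (z - s) + a%:C%C.
    have -> : a%:C%C = u * (s - z0).
      rewrite /u mulrAC conjCM_sqr -rmorphM /= -/a expr2 -mulrA divff ?mulr1//.
      by rewrite gt_eqF.
    by rewrite -mulrDr addrA subrK.
  by rewrite ReD /=; lra.
have Reh : Re ((z0 - s)^* * h) <= - (r * g).
  have -> : (z0 - s)^* * h = (- a)%:C%C * (u * h).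
    have aC : a%:C%C * (a^-1)%:C%C = 1 :> C.
      by rewrite -rmorphM /= divff ?rmorph1// gt_eqF.
    transitivity (- (s - z0)^* * (a%:C%C * (a^-1)%:C%C) * h).
      by rewrite aC mulr1 -rmorphN opprB.
    by rewrite /u rmorphN /=; ring.
  rewrite ReMreal mulNr lerN2; apply: ler_pM => //; first exact: ltW.
  by apply: le_trans Reuh; rewrite /g lerD2r.
pose l := r * g / B ^+ 2.
have l01 : 0 <= l <= 1.
  have g0' := ltW g0; have B0' := ltW B0.
  rewrite /l divr_ge0 ?mulr_ge0 ?exprn_ge0//= ler_pdivrMr ?exprn_gt0// mul1r.
  by rewrite expr2 ler_pM// (le_trans gr).
have := rle _ (Wconv _ _ _ Wz Wz0 l01).
rewrite -(ler_pXn2r (n := 2))// ?nnegrE ?cabs_ge0//.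
have -> : cabs (s - (l%:C%C * z + (1 - l)%:C%C * z0)) ^+ 2 =
    a ^+ 2 + 2 * l * Re ((z0 - s)^* * h) + l ^+ 2 * cabs h ^+ 2.
  rewrite /a /h !cabs_sqr; move: (s) (z0) (z) (l) => [? ?] [? ?] [? ?] ? /=.
  by ring.
have ar2 : a ^+ 2 < r ^+ 2 + (r * g / B) ^+ 2.
  rewrite -[ltRHS]sqr_sqrtr ?addr_ge0 ?sqr_ge0// ltr_pXn2r// nnegrE ?sqrtr_ge0//.
  exact: ltW.
have l0 : 0 <= l by case/andP: l01.
have lB : l ^+ 2 * cabs h ^+ 2 <= (r * g / B) ^+ 2.
  have -> : r * g / B = l * B by rewrite /l; field; rewrite gt_eqF.
  have B0' := ltW B0; have h0 := cabs_ge0 h.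
  rewrite -exprMn; apply: lerXn2r; last exact: ler_wpM2l.
  - by rewrite nnegrE; apply: mulr_ge0.
  - by rewrite nnegrE; apply: mulr_ge0.
have lrg : l * (r * g) = (r * g / B) ^+ 2 by rewrite /l; field; rewrite gt_eqF.
have : l * Re ((z0 - s)^* * h) <= - (l * (r * g)).
  by rewrite -mulrN ler_wpM2l.
by rewrite lrg -mulrA; lra.
Qed.

End NumericalRange.

(** * Small balls on the complex sphere *)

HB.instance Definition _ (R : realType) := isPointed.Build R[i] 0.

Section BorelVectors.
Variables (R : realType) (n : nat).
Local Notation C := R[i].

(** The generator of [borel_cV], named so that Borel sets become the measurable sets of
    [g_sigma_algebraType]. *)
Definition cV_generator : set (set 'cV[C]_n) :=
  [set E | exists (i : 'I_n) (B : set R), measurable B /\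
     (E = [set x : 'cV[C]_n | B (complex.Re (x i 0))] \/
      E = [set x : 'cV[C]_n | B (complex.Im (x i 0))])].

Local Notation borelV := (g_sigma_algebraType cV_generator).

Lemma measurable_coord_Re (i : 'I_n) :
  measurable_fun [set: borelV] (fun x : borelV => complex.Re (x i 0)).
Proof.
move=> _ B mB; rewrite setTI; apply: sub_sigma_algebra.
by exists i, B; split=> //; left.
Qed.

Lemma measurable_coord_Im (i : 'I_n) :
  measurable_fun [set: borelV] (fun x : borelV => complex.Im (x i 0)).
Proof.
move=> _ B mB; rewrite setTI; apply: sub_sigma_algebra.
by exists i, B; split=> //; right.
Qed.

(** Squaring the modulus gives a polynomial in the real and imaginary parts of the coordinates;
    hence the squared thresholds in the events below. *)
Lemma measurable_cdot_sqr (w : 'cV[C]_n) :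
  measurable_fun [set: borelV] (fun x : borelV => cabs (cdot w x) ^+ 2).
Proof.
under eq_fun do rewrite cabs_sqr cdotE Re_sum Im_sum.
apply: measurable_funD; apply: measurable_funX; apply: measurable_sum => i.
- under eq_fun do rewrite ReM.
  apply: measurable_funB; apply: measurable_funM => //.
    exact: measurable_coord_Re.
  exact: measurable_coord_Im.
- under eq_fun do rewrite ImM.
  apply: measurable_funD; apply: measurable_funM => //.
    exact: measurable_coord_Im.
  exact: measurable_coord_Re.
Qed.

Lemma borel_cdot_lt (w : 'cV[C]_n) (c : R) :
  borel_cV [set x | cabs (cdot w x) ^+ 2 < c].
Proof.
have := @measurable_cdot_sqr w measurableT `]-oo, c[%classic (measurable_itv _).
by rewrite setTI; congr (borel_cV _).
Qed.

Lemma borelI (E F : set 'cV[C]_n) : borel_cV E -> borel_cV F -> borel_cV (E `&` F).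
Proof. exact: (@measurableI _ borelV). Qed.

Lemma borelC (E : set 'cV[C]_n) : borel_cV E -> borel_cV (~` E).
Proof. exact: (@measurableC _ borelV). Qed.

Lemma borel_cdot_ge (w : 'cV[C]_n) (c : R) :
  borel_cV [set x | c <= cabs (cdot w x) ^+ 2].
Proof.
have := borelC (borel_cdot_lt w c); congr (borel_cV _).
by apply/seteqP; split => x /= ; rewrite leNgt => /negP.
Qed.

Lemma borel_csphere : borel_cV (@csphere R n).
Proof.
have mf : measurable_fun [set: borelV] (fun x : borelV => norm2 x ^+ 2).
  under eq_fun do rewrite norm2_sqr; apply: measurable_sum => i.
  under eq_fun do rewrite cabs_sqr.
  apply: measurable_funD; apply: measurable_funX.
    exact: measurable_coord_Re.
  exact: measurable_coord_Im.
have := mf measurableT [set 1] (measurable_set1 _).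
rewrite setTI; congr (borel_cV _); apply/seteqP; split => x /=.
  move=> /eqP; rewrite -[X in _ == X](expr1n _ 2) eqrXn2// ?norm2_ge0//.
  by move/eqP.
by move=> ->; rewrite expr1n.
Qed.

End BorelVectors.

Section SmallBall.
Variables (R : realType) (n : nat) (d : measure_display).
Variables (Omega : measurableType d) (P : probability Omega R).
Variable b : Omega -> 'cV[R[i]]_n.
Hypothesis bU : unif_sphere P b.
Local Notation C := R[i].

(** For nonzero [g], the map that multiplies the component along [g] by [z] and fixes the orthogonal
    complement of [g]. *)
Definition phase_rot (g : 'cV[C]_n) (z : C) : 'M[C]_n :=
  1%:M + ((z - 1) / cdot g g) *: (g *m g^t*).

Lemma phase_rotE g z (x : 'cV[C]_n) :
  phase_rot g z *m x = x + ((z - 1) / cdot g g * cdot g x) *: g.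
Proof.
rewrite /phase_rot mulmxDl mul1mx -scalemxAl -mulmxA -[_ *: g]scalerA; congr (_ + _ *: _).
apply/matrixP => i j; by rewrite (ord1 j) [LHS]mxE big_ord1 [RHS]mxE mulrC.
Qed.

Lemma phase_rot_unitary g z : g != 0 -> cabs z = 1 -> phase_rot g z \is unitarymx.
Proof.
move=> g0 z1; apply/unitarymxP.
have gg0 : cdot g g != 0 by rewrite cdotxx_eq0.
set G := g *m g^t*; set c := (z - 1) / cdot g g.
have GG : G *m G = cdot g g *: G.
  rewrite /G mulmxA -(mulmxA g) [g^t* *m g]mx11_scalar -/(cdot g g).
  by rewrite -mulmxA mul_scalar_mx -scalemxAr.
have -> : (phase_rot g z)^t* = 1%:M + c^* *: G.
  apply/matrixP => i j; rewrite /phase_rot -/c !mxE !big_ord1 !mxE.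
  by rewrite rmorphD !rmorphM /= rmorph_nat (eq_sym j i) conjCK [_^* * g i _]mulrC.
rewrite /phase_rot -/G -/c mulmxDr mulmx1 mulmxDl mul1mx -scalemxAl -scalemxAr GG.
rewrite !scalerA -addrA -!scalerDl -[RHS]addr0; congr (_ + _).
have -> : c + (c^* + c * c^* * cdot g g) = 0; last by rewrite scale0r.
have ggR : (cdot g g)^* = cdot g g by rewrite cdot_conj.
have zz : z^* * z = 1 by rewrite conjCM_sqr z1 expr1n.
have -> : c^* = (z^* - 1) / cdot g g.
  by rewrite /c rmorphM rmorphB rmorph1 fmorphV /= ggR.
transitivity ((z^* * z - 1) / cdot g g); last by rewrite zz subrr mul0r.
by rewrite /c; field.
Qed.

Lemma preim_measurable E : borel_cV E -> measurable (b @^-1` E).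
Proof. by case: bU => + _ _; exact. Qed.

(* Points of the unit circle whose real parts, hence themselves, are 1/M-separated. *)
Definition circle_point (M k : nat) : C :=
  Complex (k%:R / M%:R) (Num.sqrt (1 - (k%:R / M%:R) ^+ 2)).

Lemma cabs_circle_point M k : (k < M)%N -> cabs (circle_point M k) = 1.
Proof.
move=> kM; have M0 : 0 < M%:R :> R by rewrite ltr0n (leq_ltn_trans _ kM).
have x1 : (k%:R / M%:R) ^+ 2 <= 1 :> R.
  rewrite expr_le1 ?divr_ge0//.
  by rewrite ler_pdivrMr// mul1r ler_nat ltnW.
apply/eqP; rewrite -(eqrXn2 (n := 2))// ?cabs_ge0// cabs_sqr /=.
by rewrite sqr_sqrtr ?subr_ge0// addrC subrK expr1n.
Qed.

Lemma circle_point_sep M k l : (k < M)%N -> (l < M)%N -> k != l ->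
  M%:R^-1 <= cabs (circle_point M k - circle_point M l).
Proof.
move=> kM lM kl; rewrite (le_trans _ (ler_norm_Re _))// ReB /= -mulrBl.
have M0 : 0 < M%:R :> R by rewrite ltr0n (leq_ltn_trans _ kM).
rewrite normrM normfV (gtr0_norm M0) ler_peMl ?invr_ge0 ?(ltW M0)//.
wlog lk : k l {kM lM} kl / (l < k)%N => [H|].
  case: (ltngtP k l) kl => // [?|?] _; [rewrite distrC|];
    by apply: H => //; rewrite ?gtn_eqF ?ltn_eqF.
by rewrite -natrB 1?ltnW// normr_nat ler1n subn_gt0.
Qed.

(* The preimages of the event under M of the rotations in the direction of g are
   disjoint, since each rotation moves the product with w by more than 2t. *)
Lemma small_ball_dir (w g : 'cV[C]_n) (t r : R) (M : nat) :
  (0 < M)%N -> 0 <= t -> 0 <= r -> norm2 g ^+ 2 <= 4 -> 1 <= cabs (cdot w g) ->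
  8 * M%:R * t <= r ->
  (P (b @^-1` [set x | (cabs (cdot w x) ^+ 2 < t ^+ 2)%R /\
                     (r ^+ 2 <= cabs (cdot g x) ^+ 2)%R]) <= (M%:R^-1)%:E)%E.
Proof.
move=> M0 t0 r0 g4 wg tr; set F := [set x | _].
have [_ _ Uinv] := bU.
have g0 : g != 0.
  apply: contraTneq wg => ->; rewrite /cdot mulmx0 mxE cabs0 -ltNge.
  exact: ltr01.
have FB (w' g' : 'cV[C]_n) : borel_cV [set x | (cabs (cdot w' x) ^+ 2 < t ^+ 2)%R /\
                     (r ^+ 2 <= cabs (cdot g' x) ^+ 2)%R].
  by apply: borelI; [exact: borel_cdot_lt|exact: borel_cdot_ge].
pose U (k : 'I_M) := phase_rot g (circle_point M k).
have UU k : U k \is unitarymx.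
  by apply: phase_rot_unitary => //; exact: cabs_circle_point.
pose S (k : 'I_M) := [set o | F (U k *m b o)].
have mS k : measurable (S k).
  have := preim_measurable (FB ((U k)^t* *m w) ((U k)^t* *m g)).
  congr measurable; apply/seteqP.
  by split => o; rewrite /S /F /preimage /= -!cdot_mulmxr.
have PS k : P (S k) = P (b @^-1` F) by apply: Uinv => //; exact: FB.
have tS : trivIset [set: 'I_M] S.
  move=> k l _ _ [om [[kt kr] [lt _]]]; apply: contrapT => /eqP kl.
  move: kt kr lt g4; set x := b om; set gg := norm2 g ^+ 2 => kt kr lt g4.
  have ggE : cdot g g = gg%:C%C by rewrite cdotxx.
  have gg0 : 0 < gg by rewrite exprn_gt0// norm2_gt0.
  have ggC0 : gg%:C%C != 0 :> C by rewrite -cabs_eq0 cabs_real normr_eq0 gt_eqF.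
  pose dz := circle_point M k - circle_point M l.
  have dzM : M%:R^-1 <= cabs dz by apply: circle_point_sep.
  (* The rotation multiplies $g^*x$ by a phase, so the lower bound on its modulus also holds before
     the rotation. *)
  have gxr : r <= cabs (cdot g x).
    move: kr; rewrite /U phase_rotE cdotDr cdotZr ggE.
    have -> : cdot g x + (circle_point M k - 1) / gg%:C%C * cdot g x * gg%:C%C
        = circle_point M k * cdot g x by field.
    rewrite cabsM cabs_circle_point// mul1r.
    by rewrite ler_pXn2r// nnegrE cabs_ge0.
  have lt2 u : cabs u ^+ 2 < t ^+ 2 -> cabs u < t.
    by rewrite ltr_pXn2r// nnegrE cabs_ge0.
  have : cabs (cdot w (U k *m x) - cdot w (U l *m x)) < t + t.
    by rewrite (le_lt_trans (ler_cabsB _ _))// ltrD// lt2.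
  rewrite !phase_rotE !cdotDr !cdotZr ggE.
  have -> : cdot w x + (circle_point M k - 1) / gg%:C%C * cdot g x * cdot w g -
     (cdot w x + (circle_point M l - 1) / gg%:C%C * cdot g x * cdot w g)
     = dz * (cdot g x * cdot w g) / gg%:C%C by rewrite /dz; field.
  (* The displacement is at least $M^{-1} r / \|g\|^2 \ge r/(4M) \ge 2t$, which contradicts that
     both products lie in the disc of radius [t]. *)
  rewrite !cabsM cabsV cabs_real gtr0_norm// ltr_pdivrMr// ltNge => /negP; apply.
  have M0' : 0 < M%:R :> R by rewrite ltr0n.
  rewrite (@le_trans _ _ (M%:R^-1 * r))//.
    rewrite [leRHS]mulrC ler_pdivlMr//; apply: le_trans tr.
    have : t * gg * M%:R <= t * 4 * M%:R by rewrite !ler_wpM2r ?ler_wpM2l// ltW.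
    lra.
  rewrite ler_pM ?invr_ge0// ?(ltW M0')// -[leLHS]mulr1 ler_pM//.
have : (\sum_(k < M) P (S k) <= 1)%E.
  rewrite -(measure_bigsetU_ord _ xpredT)//; apply: probability_le1.
  exact: bigsetU_measurable.
under eq_bigr do rewrite PS.
have : measurable (b @^-1` F) by apply: preim_measurable; exact: FB.
move=> /(fin_num_measure P) /fineK <-.
rewrite sumEFin !lee_fin sumr_const card_ord -[fine _ *+ _]mulr_natl => Mp.
by rewrite -div1r ler_pdivlMr ?ltr0n// mulrC.
Qed.

Lemma measure_bigsetU_le (I : Type) (s : seq I) (F : I -> set Omega) :
  (forall i, measurable (F i)) ->
  (P (\big[setU/set0]_(i <- s) F i) <= \sum_(i <- s) P (F i))%E.
Proof.
move=> mF; elim: s => [|i s IH]; first by rewrite !big_nil measure0.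
rewrite !big_cons (le_trans (measureU2 _ _ _))//.
  exact: bigsetU_measurable.
by rewrite leeD2l.
Qed.

(** The direction [w] itself is useless for [small_ball_dir], as $w^*x$ is small on the event. But a
    unit vector has a coordinate $|x_j| \ge 1/n$, so $g_j = w \pm e_j$ satisfies $|g_j^* x| \ge 1/n
    - t \ge 1/(2n)$. The sign is that of $\mathrm{Re}\, w_j$, which keeps $|w^* g_j| \ge 1$. The
    union over the [n] coordinates costs the factor [n]. *)
Lemma small_ball (w : 'cV[C]_n) (t : R) (M : nat) :
  (0 < n)%N -> (0 < M)%N -> norm2 w = 1 -> 0 <= t -> 16 * n%:R * M%:R * t <= 1 ->
  (P (b @^-1` [set x | (cabs (cdot w x) ^+ 2 < t ^+ 2)%R]) <= (n%:R / M%:R)%:E)%E.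
Proof.
move=> n0 M0 w1 t0 tM.
have n1 : 1 <= n%:R :> R by rewrite ler1n.
have M1 : 1 <= M%:R :> R by rewrite ler1n.
have n0' : 0 < n%:R :> R by rewrite ltr0n.
have [_ Psph _] := bU.
pose e j : 'cV[C]_n := delta_mx j 0.
have ex j x : cdot (e j) x = x j 0.
  rewrite cdotE (bigD1 j)//= big1 => [|i /negbTE ij]; rewrite !mxE ?eqxx ?ij/=.
    by rewrite rmorph1 mul1r addr0.
  by rewrite rmorph0 mul0r.
pose sg j : R := if 0 <= complex.Re (w j 0) then 1 else -1.
have sgw j : sg j * complex.Re (w j 0) = `|complex.Re (w j 0)|.
  rewrite /sg; case: ifPn => h; first by rewrite mul1r ger0_norm.
  by rewrite ltr0_norm ?mulN1r// ltNge.
have sg1 j : cabs (sg j)%:C%C = 1.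
  by rewrite cabs_real /sg; case: ifP => _; rewrite ?normrN normr1.
pose g j := w + (sg j)%:C%C *: e j.
have gx j x : cdot (g j) x = cdot w x + (sg j)%:C%C * x j 0.
  by rewrite /g cdotDl cdotZl conjC_real ex.
have wg j : 1 <= cabs (cdot w (g j)).
  rewrite -cdot_conj gx cabs_conj cdotxx w1 expr1n rmorph1.
  rewrite (le_trans _ (Re_le_cabs _))// ReD ReMreal sgw.
  by rewrite lerDl.
have gg j : norm2 (g j) ^+ 2 <= 4.
  have -> : norm2 (g j) ^+ 2 = complex.Re (cdot (g j) (g j)) by rewrite cdotxx.
  rewrite gx -cdot_conj gx cdotxx w1 expr1n rmorph1 /g !mxE !eqxx mulr1.
  rewrite ReD Re_conj ReD !ReMreal ReD mulrDr sgw /=.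
  have sg2 : sg j * sg j = 1 by rewrite /sg; case: ifP => _; rewrite ?mulrNN mulr1.
  rewrite sg2; have : `|complex.Re (w j 0)| <= 1; last by lra.
  have : norm2 w ^+ 2 = 1 by rewrite w1 expr1n.
  rewrite norm2_sqr (bigD1 j)//= => wsum.
  rewrite (le_trans (ler_norm_Re _))// -(expr_le1 (n := 2))// ?cabs_ge0//.
  by rewrite -wsum lerDl sumr_ge0// => i _; rewrite sqr_ge0.
pose r : R := (2 * n%:R)^-1.
have r0 : 0 <= r by rewrite invr_ge0 mulr_ge0.
pose F j := b @^-1` [set x | (cabs (cdot w x) ^+ 2 < t ^+ 2)%R /\
                     (r ^+ 2 <= cabs (cdot (g j) x) ^+ 2)%R].
have PF j : (P (F j) <= (M%:R^-1)%:E)%E.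
  apply: (small_ball_dir M0 t0 r0 (gg j) (wg j)).
  by rewrite /r -div1r ler_pdivlMr ?mulr_gt0//; move: tM; lra.
have mF j : measurable (F j).
  apply: preim_measurable.
  by apply: borelI; [exact: borel_cdot_lt|exact: borel_cdot_ge].
pose N := b @^-1` ~` @csphere R n.
have mN : measurable N by apply: preim_measurable; apply: borelC; exact: borel_csphere.
have PN : P N = 0%E.
  rewrite /N -preimage_setC probability_setC ?Psph ?subee//.
  by apply: preim_measurable; exact: borel_csphere.
have mU : measurable (\big[setU/set0]_(j <- index_enum 'I_n) F j).
  exact: bigsetU_measurable.
rewrite (@le_trans _ _ (P (N `|` \big[setU/set0]_(j <- index_enum 'I_n) F j)))//.
  apply: le_measure; rewrite ?inE.
  - by apply: preim_measurable; exact: borel_cdot_lt.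
  - exact: measurableU.
  move=> o /= wt; have [xs|] := pselect (csphere (b o)); last by left.
  right; move: wt xs; set x := b o => wt xs.
  have [j xj] : exists j, n%:R^-1 <= cabs (x j 0).
    apply: contrapT => /forallNP nx.
    have : norm2 x ^+ 2 < 1; last by rewrite xs expr1n ltxx.
    rewrite norm2_sqr (@lt_le_trans _ _ (\sum_(i < n) n%:R^-1))//; last first.
      by rewrite sumr_const card_ord -[_^-1 *+ _]mulr_natl divff// gt_eqF.
    rewrite ltr_sum//; first by apply/hasP; exists (Ordinal n0); rewrite ?mem_index_enum.
    move=> i _; have /negP := nx i; rewrite -ltNge => xi.
    have xi0 := cabs_ge0 (x i 0).
    rewrite (le_lt_trans _ xi)// expr2 ler_piMl// (le_trans (ltW xi))// invf_le1//.
  rewrite -bigcup_seq; exists j => /=; first by rewrite mem_index_enum.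
  split => //=; rewrite -/x.
  have ct : cabs (cdot w x) < t.
    by move: wt; rewrite ltr_pXn2r// nnegrE cabs_ge0.
  apply: lerXn2r; rewrite ?nnegrE ?cabs_ge0//.
  rewrite gx addrC (le_trans _ (lerB_cabsD _ _))// cabsM sg1 mul1r.
  have tn : t <= r.
    rewrite /r -div1r ler_pdivlMr ?mulr_gt0//.
    apply: le_trans tM; have : t * n%:R * 1 <= t * n%:R * M%:R.
      by rewrite ler_wpM2l// mulr_ge0// ltW.
    have := mulr_ge0 t0 (ltW n0'); nra.
  have -> : r = n%:R^-1 - r.
    by rewrite /r; field; rewrite gt_eqF.
  by rewrite lerB// (le_trans (ltW ct)).
apply: (le_trans (measureU2 P mN mU)); rewrite [X in (X + _)%E]PN add0e.
rewrite (le_trans (measure_bigsetU_le _ _))//.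
rewrite (@le_trans _ _ (\sum_(j <- index_enum 'I_n) (M%:R^-1)%:E)%E)//.
  by apply: lee_sum.
by rewrite sumEFin lee_fin sumr_const card_ord -[_^-1 *+ _]mulr_natl.
Qed.

End SmallBall.

(** * Nearly orthonormal eigenvectors *)

Section NearOrthonormal.
Variables (R : realType) (n : nat) (V : 'M[R[i]]_n) (delta : R).
Local Notation C := R[i].
Hypothesis V1 : forall k, norm2 (col k V) = 1.
Hypothesis Vdelta : forall k,
  \sum_(l < n | l != k) cabs (cdot (col k V) (col l V)) <= delta.

(* Schur test for the off-diagonal part of the Gram matrix of the columns of V. *)
Lemma cdot_near_orthonormal (D : R) (y z : 'cV[C]_n) : 0 <= D ->
  (forall l, cabs (z l 0) <= D * cabs (y l 0)) ->
  cabs (cdot (V *m y) (V *m z) - cdot y z) <= delta * D * norm2 y ^+ 2.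
Proof.
move=> D0 zy; pose g k l := cdot (col k V) (col l V).
pose a k := cabs (y k 0); pose h k l := cabs (g k l).
have gE k l : (V^t* *m V) k l = g k l.
  by rewrite /g cdotE mxE; apply: eq_bigr => i _; rewrite !mxE.
have gkk k : g k k = 1 by rewrite /g cdotxx V1 expr1n.
have hC k l : h k l = h l k by rewrite /h /g -cdot_conj cabs_conj.
have -> : cdot (V *m y) (V *m z) - cdot y z =
    \sum_k \sum_(l | l != k) (y k 0)^* * g k l * z l 0.
  rewrite cdot_mulmxl mulmxA !cdotE -sumrB; apply: eq_bigr => k _.
  rewrite mxE -mulrBr (bigD1 k)//= gE gkk mul1r addrC addrK mulr_sumr.
  by apply: eq_bigr => l _; rewrite gE mulrA.
have -> : delta * D * norm2 y ^+ 2 = D * \sum_k a k ^+ 2 * delta.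
  by rewrite norm2_sqr -mulr_suml -mulrA mulrCA; congr (_ * _); rewrite mulrC.
rewrite (le_trans (ler_cabs_sum _ _ _))//.
have step k : cabs (\sum_(l | l != k) (y k 0)^* * g k l * z l 0) <=
    D * \sum_(l | l != k) ((a k ^+ 2 + a l ^+ 2) / 2 * h k l).
  rewrite (le_trans (ler_cabs_sum _ _ _))// mulr_sumr ler_sum// => l _.
  rewrite !cabsM cabs_conj -/(a k) -/(h k l).
  have hkl : 0 <= h k l := cabs_ge0 _.
  rewrite (@le_trans _ _ (a k * h k l * (D * a l)))//.
    by rewrite ler_wpM2l// mulr_ge0// cabs_ge0.
  rewrite [leLHS](_ : _ = D * (a k * a l * h k l)); last by ring.
  rewrite ler_wpM2l// ler_wpM2r//.
  by have := sqr_ge0 (a k - a l); nra.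
rewrite (le_trans (ler_sum _ (fun k _ => step k)))// -mulr_sumr ler_wpM2l//.
(* The modulus matrix [h] is symmetric, so the two halves have equal sums and the bound on row sums
   suffices. *)
have -> : \sum_k \sum_(l | l != k) (a k ^+ 2 + a l ^+ 2) / 2 * h k l =
    \sum_k \sum_(l | l != k) a k ^+ 2 * h k l.
  pose S := \sum_k \sum_(l | l != k) a k ^+ 2 * h k l.
  have S2 : \sum_k \sum_(l | l != k) a l ^+ 2 * h k l = S.
    rewrite (exchange_big_dep xpredT)//=; apply: eq_bigr => l _.
    by apply: eq_big => [k|k _]; [rewrite eq_sym|rewrite hC].
  transitivity ((S + S) / 2); last by rewrite -/S; field.
  rewrite -{2}S2 -big_split mulr_suml /=; apply: eq_bigr => k _.
  rewrite -big_split mulr_suml /=; apply: eq_bigr => l _.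
  by field.
by apply: ler_sum => k _; rewrite -mulr_sumr ler_wpM2l ?sqr_ge0//.
Qed.

Lemma norm2_near_orthonormal (y : 'cV[C]_n) :
  (1 - delta) * norm2 y ^+ 2 <= norm2 (V *m y) ^+ 2.
Proof.
have := @cdot_near_orthonormal 1 y y ler01 (fun l => _).
rewrite !cdotxx -rmorphB cabs_real mulr1.
move=> /(_ (fun l => ltac:(by rewrite mul1r))).
by rewrite ler_norml => /andP[+ _]; lra.
Qed.

Variables (lam : 'rV[C]_n) (A : 'M[C]_n).
Hypothesis Vu : V \in unitmx.
Hypothesis AE : A = V *m diag_mx lam *m invmx V.

Lemma eigen_mulmx (y : 'cV[C]_n) :
  A *m (V *m y) = V *m (\col_l (lam 0 l * y l 0)).
Proof.
rewrite AE !mulmxA mulmxKV// -mulmxA; congr (_ *m _).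
by apply/matrixP => i j; rewrite (ord1 j) mul_diag_mx !mxE.
Qed.

Lemma krylov_horner (K : nat) (p : {poly C}) (x : 'cV[C]_n) : (size p <= K)%N ->
  krylov K A x (V *m (\col_l (p.[lam 0 l] * (invmx V *m x) l 0))).
Proof.
move=> pK; exists (fun i : 'I_K => p`_i).
have Ax i : A ^+ i *m x = V *m (\col_l (lam 0 l ^+ i * (invmx V *m x) l 0)).
  elim: i => [|i IH].
    rewrite expr0 mul1mx -[LHS](mulKVmx Vu); congr (_ *m _).
    by apply/matrixP => l j; rewrite (ord1 j) !mxE expr0 mul1r.
  rewrite exprS -mulmxA IH eigen_mulmx; congr (_ *m _).
  by apply/matrixP => l j; rewrite !mxE exprS mulrA.
under eq_bigr => i _ do rewrite Ax scalemxAr.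
rewrite -mulmx_sumr; congr (_ *m _).
apply/matrixP => l j; rewrite (ord1 j) summxE mxE (horner_coef_wide _ pK) mulr_suml.
by apply: eq_bigr => i _; rewrite [RHS]mxE [in RHS]mxE mulrA.
Qed.

Lemma spectrumE : spectrum A = [set lam 0 l | l in [set: 'I_n]].
Proof.
apply/seteqP; split => [a /eigenvalueP[v vA v0]|_ [l _ <-]].
  have vV0 : v *m V != 0.
    by apply: contraNneq v0 => h; rewrite -(mulmxK Vu v) h mul0mx.
  have [l vl] : exists l, (v *m V) 0 l != 0.
    apply: contrapT => /forallNP h; move/eqP: vV0; apply.
    by apply/matrixP => i l; rewrite (ord1 i) [RHS]mxE; apply/eqP/negPn/negP/h.
  exists l => //; have : v *m A *m V = a *: (v *m V) by rewrite vA scalemxAl.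
  rewrite AE !mulmxA mulmxKV// => /matrixP /(_ 0 l).
  rewrite mul_mx_diag [LHS]mxE [RHS]mxE mulrC.
  exact: mulIf.
(* [eigenvalue] refers to row vectors; the rows of $V^{-1}$ are the left eigenvectors. *)
apply/eigenvalueP; exists (row l (invmx V)).
  rewrite AE !mulmxA -row_mul mulVmx// -row_mul mul1mx -row_mul.
  apply/matrixP => i j; rewrite mxE mul_diag_mx !mxE//.
apply: contraTneq Vu => h; rewrite -unitmx_inv; apply/negP => Vi.
have := congr1 (fun M => M *m V) h; rewrite -row_mul mulVmx// mul0mx.
by move=> /matrixP /(_ 0 l) /eqP; rewrite !mxE eqxx oner_eq0.
Qed.

(** With $z_l = (\lambda_l - \lambda_k) y_l$ the shifted Rayleigh quotient is $x^* V z / \|x\|^2$.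
    Near-orthonormality replaces the numerator by $y^* z$ at cost $\delta D \|y\|^2$, and bounds
    $\|x\|^2$ below by $(1-\delta)\|y\|^2$. *)
Lemma rayleigh_support (y : 'cV[C]_n) (u : C) (k : 'I_n) (D eta : R) :
  delta < 1 -> 0 <= D -> cabs u = 1 -> y != 0 ->
  (forall l, cabs (lam 0 l - lam 0 k) <= D) ->
  \sum_l - complex.Re (u * (lam 0 l - lam 0 k)) * cabs (y l 0) ^+ 2
    <= eta * D * norm2 y ^+ 2 ->
  let x := V *m y in
  0 <= eta -> 0 <= delta ->
  - ((eta + delta) / (1 - delta) * D) <=
    complex.Re (u * (cdot x (A *m x) / cdot x x - lam 0 k)).
Proof.
move=> d1 D0 u1 y0 lamD ysum x eta0 delta0.
have d1' : 0 < 1 - delta by rewrite subr_gt0.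
have Y0 : 0 < norm2 y ^+ 2 by rewrite exprn_gt0// norm2_gt0.
have Xge := norm2_near_orthonormal y; rewrite -/x in Xge.
have X0 : 0 < norm2 x ^+ 2 by rewrite (lt_le_trans _ Xge)// mulr_gt0.
have xx0 : cdot x x != 0 by rewrite cdotxx -cabs_eq0 cabs_real normr_eq0 gt_eqF.
pose z : 'cV[C]_n := \col_l ((lam 0 l - lam 0 k) * y l 0).
have Axx : cdot x (A *m x) / cdot x x - lam 0 k = cdot x (V *m z) / cdot x x.
  rewrite -[X in _ - X](mulfK xx0) -mulrBl -cdotZr eigen_mulmx.
  rewrite -[X in _ - X]mul1r -mulNr mulN1r.
  rewrite -[- cdot _ _]mulN1r -cdotZr -cdotDr; congr (cdot _ _ / _).
  rewrite scaleN1r /x scalemxAr -mulmxBr; congr (_ *m _).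
  by apply/matrixP => i j; rewrite (ord1 j) !mxE mulrBl.
rewrite Axx cdotxx mulrA -fmorphV /= [u * _ * _]mulrC ReMreal.
have := @cdot_near_orthonormal D y z D0 (fun l => _).
move=> /(_ (fun l => ltac:(by rewrite mxE cabsM ler_wpM2r ?cabs_ge0))).
rewrite -/x; set e := _ - _ => eD.
have -> : cdot x (V *m z) = cdot y z + e by rewrite /e addrC subrK.
have ReE : complex.Re (u * cdot y z) =
    - \sum_l - complex.Re (u * (lam 0 l - lam 0 k)) * cabs (y l 0) ^+ 2.
  rewrite cdotE mulr_sumr Re_sum -sumrN; apply: eq_bigr => l _.
  rewrite mxE mulNr opprK [RHS]mulrC -ReMreal -conjCM_sqr; congr complex.Re.
  by ring.
have lb : - ((eta + delta) * D * norm2 y ^+ 2) <= complex.Re (u * (cdot y z + e)).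
  rewrite mulrDr ReD ReE; have := Re_ge_cabs (u * e); rewrite cabsM u1 mul1r.
  lra.
rewrite [leRHS]mulrC ler_pdivlMr//; apply: le_trans lb; rewrite mulNr lerN2.
have -> : (eta + delta) / (1 - delta) * D * norm2 x ^+ 2 =
    (eta + delta) * D * (norm2 x ^+ 2 / (1 - delta)) by field; rewrite gt_eqF.
rewrite ler_wpM2l ?mulr_ge0 ?addr_ge0//.
by rewrite ler_pdivlMr// mulrC.
Qed.

End NearOrthonormal.

(** * Peaked polynomials *)

Section ExtremePolynomial.
Variable R : realType.
Local Notation C := R[i].
Local Notation Re := complex.Re.

(** From $1 + x \le e^x$ at $x = -1/6$, since $(5/6)^6 > 1/3$. *)
Lemma expR1_le3 : expR 1 <= 3 :> R.
Proof.
have h : (5 / 6) ^+ 6 <= expR (- 1) :> R.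
  have -> : expR (- 1) = expR (- 6^-1) ^+ 6 :> R.
    by rewrite -expRM_natl; congr expR; field.
  apply: lerXn2r; rewrite ?nnegrE ?expR_ge0//.
  apply: le_trans (expR_ge1Dx _); lra.
rewrite -[leLHS]invrK -expRN invf_ple ?posrE ?expR_gt0//.
by apply: le_trans h; lra.
Qed.

(** From $1 + x \le e^x$ at $x = 1/5$, since $(6/5)^{10} > 6$. *)
Lemma expR1_sqr_ge6 : 6 <= expR 1 ^+ 2 :> R.
Proof.
have -> : expR 1 ^+ 2 = expR 5^-1 ^+ 10 :> R.
  by rewrite -!expRM_natl; congr expR; field.
apply: (@le_trans _ _ ((6 / 5) ^+ 10)); first by lra.
apply: lerXn2r; rewrite ?nnegrE ?expR_ge0//.
apply: le_trans (expR_ge1Dx _); lra.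
Qed.

(** Split at the level $\frac{2}{3}\eta D$: the indices below it contribute at most two thirds of
    the bound, those above it at most one third because their total weight is small compared with
    [q k]. *)
Lemma weighted_sum_le (n : nat) (a q : 'I_n -> R) (D eta : R) (k : 'I_n) :
  0 <= D -> 0 <= eta -> (forall l, a l <= D) -> (forall l, 0 <= q l) ->
  \sum_(l | 2 / 3 * eta * D < a l) q l <= eta / 3 * q k ->
  \sum_l a l * q l <= eta * D * \sum_l q l.
Proof.
move=> D0 eta0 aD q0 qk.
have h l : a l * q l <= 2 / 3 * eta * D * q l +
    (if 2 / 3 * eta * D < a l then D * q l else 0).
  case: ifPn => [_|]; last by rewrite -leNgt addr0; apply: ler_wpM2r.
  by rewrite -[leLHS]add0r lerD ?mulr_ge0// ler_wpM2r.
rewrite (le_trans (ler_sum _ (fun l _ => h l)))// big_split -mulr_sumr -big_mkcond /=.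
rewrite -mulr_sumr.
have qS : q k <= \sum_l q l by rewrite (bigD1 k)//= lerDl sumr_ge0.
have : D * \sum_(l | 2 / 3 * eta * D < a l) q l <= D * (eta / 3 * \sum_l q l).
  by rewrite ler_wpM2l// (le_trans qk)// ler_wpM2l// divr_ge0.
lra.
Qed.

Lemma exp_trunc0 (F : numFieldType) K : exp_trunc K (0 : F) = 1.
Proof.
rewrite /exp_trunc big_ord_recl expr0 divr1 big1 ?addr0// => i _.
by rewrite expr0n /= mul0r.
Qed.

Lemma exp_trunc_poly K (s a : C) : exists2 p : {poly C},
  (size p <= K.+1)%N & forall x, p.[x] = exp_trunc K (s * (x - a)).
Proof.
exists (\sum_(i < K.+1) (s ^+ i / i`!%:R) *: ('X - a%:P) ^+ i).
  rewrite (leq_trans (size_sum _ _ _))//; apply/bigmax_leqP => i _.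
  by rewrite (leq_trans (size_scale_leq _ _))// size_exp_XsubC.
move=> x; rewrite horner_sum; apply: eq_bigr => i _.
by rewrite !hornerE exprMn mulrAC.
Qed.

(* The polynomial is the truncation at degree 6m of exp (3m/(4D) u (x - lam k)). *)
Lemma extreme_poly (n m : nat) (lam c : 'I_n -> C) (u : C) (k : 'I_n) (D L : R) :
  (0 < m)%N -> 3 <= L -> m%:R <= expR L -> 0 < D -> cabs u = 1 ->
  (forall l, cabs (lam l - lam k) <= D) ->
  (forall l, Re (u * (lam l - lam k)) <= 0) ->
  \sum_l cabs (c l) ^+ 2 <= 2 -> expR (- (5 * L)) <= cabs (c k) ^+ 2 ->
  exists p : {poly C}, [/\ (size p <= 6 * m + 1)%N, p.[lam k] = 1 &
    \sum_l - Re (u * (lam l - lam k)) * cabs (p.[lam l] * c l) ^+ 2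
      <= 6 / m%:R * L * D * \sum_l cabs (p.[lam l] * c l) ^+ 2].
Proof.
move=> m0 L3 mL D0 u1 lamD lamu c2 ck.
have m0' : 0 < m%:R :> R by rewrite ltr0n.
pose eta := 6 / m%:R * L.
have eta0 : 0 <= eta by rewrite /eta mulr_ge0 ?divr_ge0//; lra.
have aD l : - Re (u * (lam l - lam k)) <= D.
  rewrite (le_trans _ (lamD l))// -[leRHS]mul1r -u1 -cabsM lerNl.
  exact: Re_ge_cabs.
(* For $\eta \ge 1$ the constant polynomial suffices, as every deviation is at most [D]; otherwise
   $m > 6L$. *)
have [eta1|eta1] := leP 1 eta.
  exists 1; split; [by rewrite size_poly1 addn1| by rewrite hornerC|].
  rewrite mulr_sumr ler_sum// => l _; rewrite ler_wpM2r ?sqr_ge0//.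
  by rewrite (le_trans (aD l))// -/eta ler_peMl// ltW.
have mL6 : 6 * L < m%:R.
  by move: eta1; rewrite /eta mulrAC ltr_pdivrMr// mul1r.
pose tau := 3 * m%:R / (4 * D).
have tau0 : 0 <= tau by rewrite /tau divr_ge0 ?mulr_ge0 ?ltW.
have [p sp pE] := exp_trunc_poly (6 * m) (tau%:C%C * u) (lam k).
have pk : p.[lam k] = 1 by rewrite pE subrr mulr0 exp_trunc0.
exists p; split => //; first by rewrite addn1.
apply: (weighted_sum_le (k := k)) => //; [exact: ltW|by move=> l; exact: sqr_ge0|].
rewrite pk mul1r -/eta.
have big l : 2 / 3 * eta * D < - Re (u * (lam l - lam k)) ->
    cabs (p.[lam l] * c l) ^+ 2 <= 3 * expR (- (6 * L)) * cabs (c l) ^+ 2.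
  move=> al; rewrite cabsM exprMn ler_wpM2r ?sqr_ge0//.
  rewrite pE -mulrA (le_trans (exp_trunc_sqr_le _ _))// ReMreal.
  rewrite cabsM cabs_real ger0_norm//.
  (* The value of [tau] is chosen such that $2\tau \cdot \frac{2}{3}\eta D = 6L$. *)
  have e1 : expR (2 * (tau * Re (u * (lam l - lam k)))) <= expR (- (6 * L)).
    rewrite ler_expR -lerN2 opprK -!mulrN mulrA.
    apply: le_trans (ler_wpM2l _ (ltW al)); last by rewrite mulr_ge0.
    by rewrite le_eqVlt; apply/orP; left; apply/eqP; rewrite /tau /eta; field; rewrite !gt_eqF.
  have z3 : tau * cabs (u * (lam l - lam k)) <= 3 / 4 * m%:R.
    rewrite cabsM u1 mul1r (le_trans (ler_wpM2l tau0 (lamD l)))//.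
    by rewrite le_eqVlt; apply/orP; left; apply/eqP; rewrite /tau; field; rewrite gt_eqF.
  (* As $\tau D = \frac{3}{4} m$ and $e \le 3$, the exponent is at most $\frac{9}{2}m - 6m =
     -\frac{3}{2}m$, below $-6L$ because $m > 6L$. *)
  have e2 : expR (expR 1 * (2 * (tau * cabs (u * (lam l - lam k)))) - (6 * m)%:R)
      <= expR (- (6 * L)).
    rewrite ler_expR natrM.
    have z0 : 0 <= 2 * (tau * cabs (u * (lam l - lam k))).
      by apply: mulr_ge0 => //; apply: mulr_ge0 => //; exact: cabs_ge0.
    have : expR 1 * (2 * (tau * cabs (u * (lam l - lam k)))) <=
        3 * (2 * (3 / 4 * m%:R)).
      by apply: ler_pM => //; [exact: expR1_le3|exact: ler_wpM2l].
    lra.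
  lra.
have s1 : \sum_(l | 2 / 3 * eta * D < - Re (u * (lam l - lam k)))
     cabs (p.[lam l] * c l) ^+ 2 <= 6 * expR (- (6 * L)).
  rewrite (le_trans (ler_sum _ big))// -mulr_sumr.
  have : \sum_(l | 2 / 3 * eta * D < - Re (u * (lam l - lam k))) cabs (c l) ^+ 2 <= 2.
    rewrite (le_trans _ c2)//.
    rewrite [leRHS](bigID (fun l => 2 / 3 * eta * D < - Re (u * (lam l - lam k))))/=.
    by rewrite lerDl sumr_ge0// => l _; rewrite sqr_ge0.
  have e0 := expR_ge0 (- (6 * L)); nra.
rewrite (le_trans s1)//.
(* The factor $e^{-5L}$ is absorbed by the lower bound on $|c_k|^2$, and $6e^{-L} \le 6/m \le
   \eta/3$ by $m \le e^L$ and $L \ge 3$. *)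
have -> : - (6 * L) = - L - 5 * L by ring.
rewrite expRD mulrA ler_pM ?mulr_ge0 ?expR_ge0//.
rewrite /eta expRN -[leLHS]/(6 / expR L).
have mLe : (expR L)^-1 <= m%:R^-1 by rewrite lef_pV2 ?posrE ?expR_gt0.
have mi0 : 0 <= m%:R^-1 :> R by rewrite invr_ge0 ltW.
by have : m%:R^-1 * 3 <= m%:R^-1 * L := ler_wpM2l mi0 L3; lra.
Qed.

End ExtremePolynomial.

(** * Convex hulls and diameters *)

Section ConvexHull.
Variable R : realType.
Local Notation C := R[i].
Local Notation Re := complex.Re.

Lemma sub_convex_hull (S : set C) : S `<=` convex_hull S.
Proof.
move=> s Ss; exists 1%N, (fun=> 1), (fun=> s).
by split => //; rewrite big_ord1// mul1r.
Qed.

Lemma convex_hull_cabs_le (S : set C) (B : R) (s : C) :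
  (forall z, S z -> cabs z <= B) -> convex_hull S s -> cabs s <= B.
Proof.
move=> SB [p [t [z [t0 t1 Sz ->]]]].
rewrite (le_trans (ler_cabs_sum _ _ _))// -[B]mul1r -t1 mulr_suml ler_sum// => i _.
by rewrite cabsM cabs_real ger0_norm// ler_wpM2l// SB.
Qed.

Lemma convex_hull_Re_le (S : set C) (u : C) (B : R) (s : C) :
  (forall z, S z -> Re (u * z) <= B) -> convex_hull S s -> Re (u * s) <= B.
Proof.
move=> SB [p [t [z [t0 t1 Sz ->]]]].
rewrite mulr_sumr Re_sum -[B]mul1r -t1 mulr_suml ler_sum// => i _.
by rewrite mulrCA ReMreal ler_wpM2l// SB.
Qed.

Lemma cabs_le_diam (S : set C) (B : R) (s t : C) :
  (forall z, S z -> cabs z <= B) -> S s -> S t -> cabs (s - t) <= diam S.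
Proof.
move=> SB Ss St; apply: ub_le_sup; last by exists s, t.
exists (B + B) => _ [z1 [z2 [S1 S2 ->]]].
by rewrite (le_trans (ler_cabsB _ _))// lerD ?SB.
Qed.

Lemma diam_ge0 (S : set C) : 0 <= diam S.
Proof.
(* [sup] takes the value 0 on a set without a supremum. *)
rewrite /diam; have [supS|/sup_out ->] := pselect (has_sup
    [set r : R | exists s t : C, [/\ S s, S t & r = cabs (s - t)]]); last by [].
have [r Sr] := supS.1; apply: le_trans (sup_upper_bound supS Sr).
by have [s [t [_ _ ->]]] := Sr; exact: cabs_ge0.
Qed.

End ConvexHull.

(** * Boundedness of matrices and the condition number *)

Section MatrixBounds.
Variable R : realType.
Local Notation C := R[i].

(** A crude constant: only its finiteness matters, to make the numerical range bounded and the
    spectral norm a true supremum. *)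
Lemma norm2_mulmx_le m n (M : 'M[C]_(m, n)) (x : 'cV[C]_n) :
  norm2 (M *m x) ^+ 2 <= (\sum_i (\sum_j cabs (M i j)) ^+ 2) * norm2 x ^+ 2.
Proof.
rewrite norm2_sqr mulr_suml ler_sum// => i _; rewrite -exprMn.
apply: lerXn2r; rewrite ?nnegrE ?cabs_ge0 ?mulr_ge0 ?sqrtr_ge0//.
  by rewrite sumr_ge0// => j _; exact: cabs_ge0.
rewrite mxE (le_trans (ler_cabs_sum _ _ _))// mulr_suml ler_sum// => j _.
rewrite cabsM ler_wpM2l ?cabs_ge0// -(ler_pXn2r (n := 2))// ?nnegrE ?cabs_ge0 ?norm2_ge0//.
rewrite norm2_sqr (bigD1 j)//= lerDl sumr_ge0// => l _.
exact: sqr_ge0.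
Qed.

Lemma numerical_range_bounded k (M : 'M[C]_k) :
  exists B : R, forall z, numerical_range M z -> cabs z <= B.
Proof.
exists ((1 + \sum_i (\sum_j cabs (M i j)) ^+ 2) / 2) => _ [x /= x0 <-].
have X0 : 0 < norm2 x ^+ 2 by rewrite exprn_gt0// norm2_gt0.
rewrite cabsM cabsV cdotxx cabs_real gtr0_norm// ler_pdivrMr//.
rewrite (le_trans (cabs_cdot_le _ _))//.
by have := norm2_mulmx_le M x; lra.
Qed.

Lemma spectral_norm_ge m n (M : 'M[C]_(m, n)) (x : 'cV[C]_n) :
  norm2 x = 1 -> norm2 (M *m x) <= spectral_norm M.
Proof.
move=> x1; apply: ub_le_sup; last by exists x.
exists (1 + \sum_i (\sum_j cabs (M i j)) ^+ 2) => _ [y /= y1 <-].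
have := norm2_mulmx_le M y; rewrite y1 expr1n mulr1.
by have := sqr_ge0 (norm2 (M *m y) - 2^-1); lra.
Qed.

Lemma cond2_ge1 n (V : 'M[C]_n) (k : 'I_n) :
  V \in unitmx -> norm2 (col k V) = 1 -> 1 <= cond2 V.
Proof.
move=> Vu V1; pose e : 'cV[C]_n := delta_mx k 0.
have Ve : V *m e = col k V by rewrite colE.
have e1 : norm2 e = 1.
  have eE i : e i 0 = (i == k)%:R by rewrite mxE eqxx andbT.
  rewrite /norm2 (bigD1 k)//= big1 => [|i /negbTE ik].
    by rewrite eE eqxx mulr1n cabs1 expr1n addr0 sqrtr1.
  by rewrite eE ik mulr0n cabs0 expr0n.
rewrite -[1]mulr1 ler_pM//.
  by rewrite -V1 -Ve spectral_norm_ge.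
by rewrite -e1 -(mulKmx Vu e) spectral_norm_ge// Ve.
Qed.

End MatrixBounds.

(** * The one-sided Hausdorff distance *)

Section HausdorffBound.
Variables (R : realType) (n m : nat) (A V : 'M[R[i]]_n) (lam : 'rV[R[i]]_n).
Variables (delta L : R) (x : 'cV[R[i]]_n).
Local Notation C := R[i].
Local Notation Re := complex.Re.
Local Notation c := (invmx V *m x).
Local Notation K := (convex_hull (spectrum A)).

Lemma one_sided_hausdorff_krylov (k0 : 'I_n) (d : nat) (Q : 'M[C]_(n, d)) :
  (0 < m)%N -> 3 <= L -> m%:R <= expR L ->
  (forall k, norm2 (col k V) = 1) ->
  (forall k, \sum_(l < n | l != k) cabs (cdot (col k V) (col l V)) <= delta) ->
  0 <= delta < 1 -> V \in unitmx -> A = V *m diag_mx lam *m invmx V ->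
  norm2 c ^+ 2 <= 2 -> (forall k, expR (- (5 * L)) <= cabs (c k 0) ^+ 2) ->
  0 < diam K -> orthonormal_basis Q (krylov (6 * m + 1) A x) ->
  one_sided_hausdorff K (numerical_range (Q^t* *m A *m Q)) <=
    (6 / m%:R * L + delta) / (1 - delta) * diam K.
Proof.
move=> m0 L3 mL V1 Vdelta /andP[delta0 delta1] Vu AE c2 ck D0 [Q1 Qr].
have spE := spectrumE Vu AE.
have lamS l : spectrum A (lam 0 l) by rewrite spE; exists l.
have lamB z : spectrum A z -> cabs z <= \sum_l cabs (lam 0 l).
  rewrite spE => -[l _ <-]; rewrite (bigD1 l)//= lerDl sumr_ge0// => j _.
  exact: cabs_ge0.
have lamD k l : cabs (lam 0 l - lam 0 k) <= diam K.
  apply: (@cabs_le_diam _ _ (\sum_j cabs (lam 0 j))).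
  - by move=> z; exact: convex_hull_cabs_le.
  - exact: sub_convex_hull.
  - exact: sub_convex_hull.
set W := numerical_range _; set rho := _ * diam K.
have m0' : 0 < m%:R :> R by rewrite ltr0n.
have eta0 : 0 <= 6 / m%:R * L by apply: mulr_ge0; [exact: divr_ge0|lra].
have rho0 : 0 <= rho.
  apply: mulr_ge0; last exact: ltW.
  by apply: divr_ge0; [exact: addr_ge0|rewrite subr_ge0 ltW].
have supp u s : cabs u = 1 -> K s -> exists2 z, W z & - rho <= Re (u * (z - s)).
  move=> u1 Ks.
  have [k _ kmax] := @arg_maxP _ _ _ k0 xpredT (fun l => Re (u * lam 0 l)) isT.
  have kle l : Re (u * (lam 0 l - lam 0 k)) <= 0.
    by rewrite mulrBr ReB subr_le0; exact: kmax.
  have c2' : \sum_l cabs (c l 0) ^+ 2 <= 2 by rewrite -norm2_sqr.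
  have [p [sp pk psum]] := extreme_poly m0 L3 mL D0 u1 (lamD k) kle c2' (ck k).
  pose y : 'cV[C]_n := \col_l (p.[lam 0 l] * c l 0).
  have y0 : y != 0.
    apply: contraTneq (ck k) => /matrixP /(_ k 0); rewrite !mxE pk mul1r => h.
    by rewrite -ltNge h cabs0 expr0n expR_gt0.
  have : krylov (6 * m + 1) A x (V *m y) := krylov_horner Vu AE x sp.
  rewrite -Qr => -[v _ Qv].
  have Vy0 : V *m y != 0.
    by apply: contraNneq y0 => h; rewrite -(mulKmx Vu y) h mulmx0.
  have zE : cdot v (Q^t* *m A *m Q *m v) / cdot v v =
      cdot (V *m y) (A *m (V *m y)) / cdot (V *m y) (V *m y).
    by rewrite -Qv !cdot_mulmxl !mulmxA Q1 mul1mx.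
  exists (cdot v (Q^t* *m A *m Q *m v) / cdot v v).
    by exists v => //=; apply: contraNneq Vy0 => v0; rewrite -Qv v0 mulmx0.
  have ysum : \sum_l - Re (u * (lam 0 l - lam 0 k)) * cabs (y l 0) ^+ 2
      <= 6 / m%:R * L * diam K * norm2 y ^+ 2.
    rewrite norm2_sqr; under eq_bigr => l _ do rewrite mxE.
    by under [in leRHS]eq_bigr => l _ do rewrite mxE.
  have := rayleigh_support V1 Vdelta Vu AE delta1 (ltW D0) u1 y0 (lamD k) ysum eta0 delta0.
  rewrite -zE -/rho => /le_trans; apply.
  (* The estimate is relative to $\lambda_k$; a point [s] of the hull lies no further out in the
     direction [u]. *)
  rewrite !mulrBr !ReB lerD2l lerN2.
  apply: convex_hull_Re_le Ks => z; rewrite spE => -[l _ <-].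
  exact: kmax.
have Kne : K !=set0 by exists (lam 0 k0); exact: sub_convex_hull.
have [B WB] := numerical_range_bounded (Q^t* *m A *m Q).
apply: ge_sup; first by have [s Ks] := Kne; exists (inf [set cabs (s - t) | t in W]), s.
move=> _ [s Ks <-]; apply: (inf_dist_le_support (D := B)) => //.
- by have [z Wz _] := supp 1 s (cabs1 _) Ks; exists z.
- by move=> z1 z2 t; exact: numerical_range_convex.
- by move=> u u1; exact: supp.
Qed.

End HausdorffBound.

(** * Consequences of beta-normality *)

Section BetaNormal.
Variables (R : realType) (n : nat) (beta : R) (V : 'M[R[i]]_n).
Hypothesis VN : beta_normal beta V.

Local Notation w k := (col k ((invmx V)^t*)).

Lemma cdot_dual (k : 'I_n) (x : 'cV[R[i]]_n) : cdot (w k) x = (invmx V *m x) k 0.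
Proof.
by rewrite cdotE mxE; apply: eq_bigr => j _; rewrite !mxE conjCK.
Qed.

(** Biorthogonality gives $w_k^* v_k = 1$ with $\|v_k\| = 1$. *)
Lemma norm2_dual_ge1 (k : 'I_n) : 1 <= norm2 (w k) ^+ 2.
Proof.
case: VN => _ Vu /(_ k) V1 _.
have := cabs_cdot_le (w k) (col k V).
rewrite cdot_dual V1.
have -> : (invmx V *m col k V) k 0 = 1.
  by rewrite colE mulmxA mulVmx// mul1mx mxE !eqxx.
by rewrite cabs1 expr1n; lra.
Qed.

Lemma beta_normal_coherence (k : 'I_n) :
  \sum_(l < n | l != k) cabs (cdot (col k V) (col l V)) <= n%:R `^ (- beta).
Proof.
case: VN => _ _ _ /(_ k k) h.
have W0 : 0 < norm2 (w k) ^+ 2 by rewrite (lt_le_trans ltr01)// norm2_dual_ge1.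
rewrite -(ler_pM2r W0) (le_trans _ h)// mulr_suml ler_sum// => l _.
rewrite ler_wpM2l ?cabs_ge0// cdotxx cabs_real.
by rewrite ger0_norm ?sqr_ge0// lerDr cabs_ge0.
Qed.

End BetaNormal.

(** * The high-probability event *)

Section GoodEvent.
Variables (R : realType) (n : nat) (d : measure_display).
Variables (Omega : measurableType d) (P : probability Omega R).
Variable b : Omega -> 'cV[R[i]]_n.
Hypothesis bU : unif_sphere P b.

(** A union bound over [n] slabs of probability at most $n/M$ each; the complement of the sphere, a
    null set, is discarded as well. *)
Lemma small_ball_union (w : 'I_n -> 'cV[R[i]]_n) (t : R) (M : nat) :
  (0 < n)%N -> (0 < M)%N -> (forall k, norm2 (w k) = 1) -> 0 <= t ->
  16 * n%:R * M%:R * t <= 1 ->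
  exists G : set Omega, [/\ measurable G,
    ((1 - n%:R ^+ 2 / M%:R)%:E <= P G)%E &
    forall o, G o -> norm2 (b o) = 1 /\
      forall k, t ^+ 2 <= cabs (cdot (w k) (b o)) ^+ 2].
Proof.
move=> n0 M0 w1 t0 tM.
pose F k := b @^-1` [set x | (cabs (cdot (w k) x) ^+ 2 < t ^+ 2)%R].
pose U := \big[setU/set0]_(k <- index_enum 'I_n) F k.
have mF k : measurable (F k) by apply: (preim_measurable bU); exact: borel_cdot_lt.
have mU : measurable U by exact: bigsetU_measurable.
pose S := b @^-1` @csphere R n.
have mS : measurable S by apply: (preim_measurable bU); exact: borel_csphere.
have [_ PS _] := bU.
have PU : (P U <= (n%:R ^+ 2 / M%:R)%:E)%E.
  rewrite (le_trans (measure_bigsetU_le P _ mF))//.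
  rewrite (@le_trans _ _ (\sum_(k <- index_enum 'I_n) (n%:R / M%:R)%:E)%E)//.
    by apply: lee_sum => k _; exact: small_ball.
  rewrite sumEFin lee_fin sumr_const card_ord -[(_ / _) *+ _]mulr_natl.
  by rewrite mulrA expr2.
have PSC : P (~` S) = 0%E by rewrite probability_setC// PS subee.
exists (~` (~` S `|` U)); split.
- by apply: measurableC; apply: measurableU => //; exact: measurableC.
- rewrite probability_setC; last by apply: measurableU => //; exact: measurableC.
  rewrite EFinB leeB//; apply: le_trans PU.
  rewrite (le_trans (measureU2 P (measurableC mS) mU))//.
  by rewrite [X in (X + _)%E]PSC add0e.
move=> o /not_orP[/contrapT So Uo]; split => // k.
rewrite leNgt; apply/negP => h; apply: Uo.
by rewrite /U -bigcup_seq; exists k => //=; exact: mem_index_enum.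
Qed.

End GoodEvent.

(** * Numerical consequences of the parameter ranges *)

Section Numerics.
Variable R : realType.
Implicit Types (N alpha beta gamma : R).

(** The upper bound is the lower bound on [beta], multiplied by $\frac{1}{2}\ln N$ and
    exponentiated. *)
Lemma two_ln_lt_powR N beta : 2 <= N ->
  2 * ln (2 * ln (expR 1 * N)) / ln N < beta ->
  2 <= 2 * ln (expR 1 * N) < N `^ (beta / 2).
Proof.
move=> N2 h; have N0 : 0 < N by lra.
have lnN : 0 < ln N by rewrite ln_gt0//; lra.
have lE : ln (expR 1 * N) = 1 + ln N by rewrite lnM ?posrE ?expR_gt0// expRK.
have q0 : 0 < 2 * ln (expR 1 * N) by rewrite lE; lra.
rewrite lE in h q0 *; apply/andP; split; first by lra.
rewrite -[ltLHS]lnK ?posrE// /powR gt_eqF// ltr_expR.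
by move: h; rewrite ltr_pdivrMr//; lra.
Qed.

(** Each subtracted term is then below 1: the last one gives $n^{1/4} > 4$, and the first one gives
    $m \le n^\alpha$ because $e^2 \ge 6$. *)
Lemma nontrivial_prob (n m : nat) (alpha beta gamma : R) :
  (2 <= n)%N -> (0 < m)%N -> 0 < gamma ->
  0 < 1 - (expR 1 ^+ 2 * m%:R) / (6 * n%:R `^ alpha)
       - expR 1 / n%:R `^ (beta / 2 - gamma)
       - 2 / n%:R `^ (1 / 2 - gamma)
       - 4 / n%:R `^ (1 / 4 - gamma) ->
  256 <= n%:R :> R /\ m%:R <= n%:R `^ alpha.
Proof.
move=> n2 m0 g0 h.
have N2 : 2 <= n%:R :> R by rewrite ler_nat.
have N0 : 0 < n%:R :> R by lra.
have pw y : 0 < n%:R `^ y :> R by exact: powR_gt0.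
have m1 : 1 <= m%:R :> R by rewrite ler1n.
have h1 : 0 <= (expR 1 ^+ 2 * m%:R) / (6 * n%:R `^ alpha).
  by rewrite divr_ge0 ?mulr_ge0 ?sqr_ge0 ?powR_ge0.
have h2 : 0 <= expR 1 / n%:R `^ (beta / 2 - gamma) by rewrite divr_ge0 ?expR_ge0 ?powR_ge0.
have h3 : 0 <= 2 / n%:R `^ (1 / 2 - gamma) by rewrite divr_ge0 ?powR_ge0.
have h4 : 0 <= 4 / n%:R `^ (1 / 4 - gamma) by rewrite divr_ge0 ?powR_ge0.
split.
  have : 4 / n%:R `^ (1 / 4 - gamma) < 1 :> R by lra.
  rewrite ltr_pdivrMr// [1 * _ `^ _]mul1r => n4.
  have n4' : 4 <= n%:R `^ (1 / 4) :> R.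
    by apply: (le_trans (ltW n4)); apply: ler_powR; lra.
  have -> : n%:R = (n%:R `^ (1 / 4)) ^+ 4 :> R.
    rewrite -powR_mulrn ?powR_ge0// -powRrM.
    have -> : 1 / 4 * 4%:R = 1 :> R by field.
    by rewrite powRr1 ?ltW.
  have -> : 256 = 4 ^+ 4 :> R by ring.
  by apply: lerXn2r; rewrite ?nnegrE ?powR_ge0.
have : (expR 1 ^+ 2 * m%:R) / (6 * n%:R `^ alpha) < 1 by lra.
rewrite ltr_pdivrMr ?mulr_gt0// mul1r => h5.
have : 6 * m%:R <= expR 1 ^+ 2 * m%:R :> R by rewrite ler_wpM2r// expR1_sqr_ge6.
lra.
Qed.

End Numerics.

Theorem theorem4p10 (R : realType) (n m : nat) (alpha beta gamma : R)
    (A V : 'M[R[i]]_n) (lam : 'rV[R[i]]_n)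
    (d : measure_display) (Omega : measurableType d) (P : probability Omega R)
    (b : Omega -> 'cV[R[i]]_n) :
  (2 <= n)%N ->
  2 * ln (2 * ln (expR 1 * n%:R)) / ln n%:R < beta ->
  (0 < m)%N ->
  0 < alpha ->
  beta_normal beta V ->
  A = V *m diag_mx lam *m invmx V ->
  unif_sphere P b ->
  0 < gamma -> gamma < Num.min (beta / 2) (1 / 4) ->
  2 * pi / n%:R `^ gamma < pi / 2 ->
  with_prob_ge P
    (1 - (expR 1 ^+ 2 * m%:R) / (6 * n%:R `^ alpha)
       - expR 1 / n%:R `^ (beta / 2 - gamma)
       - 2 / n%:R `^ (1 / 2 - gamma)
       - 4 / n%:R `^ (1 / 4 - gamma))
    [set w | forall (k : nat) (Q : 'M[R[i]]_(n, k)),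
      orthonormal_basis Q (krylov (6 * m + 1) A (b w)) ->
      one_sided_hausdorff (convex_hull (spectrum A)) (numerical_range (Q^t* *m A *m Q))
        / diam (convex_hull (spectrum A))
      <= (6 / m%:R * ln (n%:R `^ (2 + alpha) * cond2 V ^+ 2)
            + 2 * ln (expR 1 * n%:R) / n%:R `^ (beta / 2))
           / (1 - 2 * ln (expR 1 * n%:R) / n%:R `^ (beta / 2))
         + pi / n%:R `^ gamma * tan (2 * pi / n%:R `^ gamma)].
Proof.
move=> n2 hbeta m0 alpha0 VN AE bU g0 gmin gpi.
set p := 1 - _ - _ - _ - _; set event := [set _ | _].
(* If the claimed probability is not positive, the empty event will do. *)
have [p0|p0] := leP p 0.
  by exists set0; split; rewrite ?measure0 ?lee_fin.
have [N256 mN] := nontrivial_prob n2 m0 g0 p0.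
set N := n%:R in N256 mN *.
have N0 : 0 < N by lra.
have N1 : 1 <= N by lra.
have m1 : 1 <= m%:R :> R by rewrite ler1n.
pose k0 : 'I_n := Ordinal (leq_trans (isT : (0 < 2)%N) n2).
have [beta0 Vu V1 _] := VN.
pose X := N `^ (2 + alpha).
have XE : X = N ^+ 2 * N `^ alpha.
  rewrite /X powRD; last by rewrite (gt_eqF N0) implybT.
  by rewrite powR_mulrn// ltW.
have Na1 : 1 <= N `^ alpha by rewrite (le_trans m1).
have XN2 : N ^+ 2 <= X by rewrite XE ler_peMr// sqr_ge0.
have XNa : N `^ alpha <= X by rewrite XE ler_peMl ?powR_ge0// exprn_ege1.
have X0 : 0 < X by rewrite (lt_le_trans _ XN2)// exprn_gt0.
pose L := ln (X * cond2 V ^+ 2).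
have kap1 : 1 <= cond2 V := cond2_ge1 Vu (V1 k0).
have eL : X <= expR L.
  have kap0 : 0 < cond2 V by lra.
  rewrite /L lnK; last by rewrite posrE mulr_gt0// exprn_gt0.
  by rewrite ler_peMr ?(ltW X0)// exprn_ege1.
(* $e^3 \le 27 \le n^2 \le X \le e^L$. *)
have L3 : 3 <= L.
  rewrite -ler_expR (le_trans _ eL)// (le_trans _ XN2)//.
  have -> : expR 3 = expR 1 ^+ 3 :> R by rewrite -expRM_natl mulr1.
  apply: (@le_trans _ _ (3 ^+ 3)).
    by apply: lerXn2r; rewrite ?nnegrE ?expR_ge0// expR1_le3.
  nra.
have mL : m%:R <= expR L by rewrite (le_trans mN)// (le_trans XNa).
(* An integer between $n^{2+\alpha}$ and twice that, so that the union bound $n^2/M$ is at most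
   $n^{-\alpha}$. *)
pose M := (Num.truncn X).+1.
have M0 : (0 < M)%N by [].
have [XM1 XM2] : X <= M%:R /\ M%:R <= 2 * X.
  have X1 : 1 <= X by rewrite (le_trans _ XNa).
  have /andP[tX Xt] := truncn_itv (ltW X0).
  split; first exact: ltW.
  by rewrite /M -natr1; lra.
have M0' : 0 < M%:R :> R by rewrite ltr0n.
pose t : R := (16 * N * M%:R)^-1.
have t0 : 0 <= t by rewrite invr_ge0 !mulr_ge0// ltW.
have tM : 16 * N * M%:R * t <= 1 by rewrite divff// !mulf_neq0 ?gt_eqF.
pose w k := col k ((invmx V)^t*).
have wge k : 1 <= norm2 (w k) by rewrite -(expr_ge1 (n := 2)) ?norm2_ge0// (norm2_dual_ge1 VN).
(* The small-ball estimate concerns unit vectors. As $\|w_k\| \ge 1$, normalizing only decreases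
   $|w_k^* b| = |c_k|$, so a lower bound for [w1] carries over. *)
pose w1 k := (norm2 (w k))^-1%:C%C *: w k.
have w11 k : norm2 (w1 k) = 1.
  rewrite norm2Z cabs_real ger0_norm ?invr_ge0 ?norm2_ge0// mulVf// gt_eqF//.
  exact: lt_le_trans (wge k).
have [G [mG PG Gb]] := small_ball_union bU (ltn_trans (isT : (0 < 1)%N) n2) M0 w11 t0 tM.
exists G; split => //; last first.
  apply: le_trans PG; rewrite lee_fin -/N.
  have q1 : N ^+ 2 / M%:R <= (expR 1 ^+ 2 * m%:R) / (6 * N `^ alpha).
    rewrite (@le_trans _ _ (N ^+ 2 / X))//.
      by rewrite ler_wpM2l ?sqr_ge0// lef_pV2 ?posrE.
    have Na0 : 0 < N `^ alpha by rewrite powR_gt0.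
    rewrite XE invfM mulrA divff ?mul1r; last by rewrite expf_neq0// gt_eqF.
    rewrite ler_pdivlMr ?mulr_gt0// mulrCA mulVf ?gt_eqF// mulr1.
    apply: (le_trans (expR1_sqr_ge6 R)).
    by rewrite ler_peMr// sqr_ge0.
  have pw y : 0 <= N `^ y by exact: powR_ge0.
  have r1 : 0 <= expR 1 / N `^ (beta / 2 - gamma) by rewrite divr_ge0 ?expR_ge0.
  have r2 : 0 <= 2 / N `^ (1 / 2 - gamma) by rewrite divr_ge0.
  have r3 : 0 <= 4 / N `^ (1 / 4 - gamma) by rewrite divr_ge0.
  by rewrite /p -/N; lra.
move=> o Go k Q Qb; have [] := Gb _ Go; move: Qb; set x := b o => Qb x1 xw.
pose s := N `^ (beta / 2).
have N2 : 2 <= N by lra.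
have /andP[l2 ls] : 2 <= 2 * ln (expR 1 * N) < s := two_ln_lt_powR N2 hbeta.
have s2 : 2 < s by exact: le_lt_trans ls.
have s0 : 0 < s by lra.
set q := 2 * ln (expR 1 * N) / s.
have q1 : q < 1 by rewrite ltr_pdivrMr// mul1r.
pose delta := N `^ (- beta).
have deltaE : delta = s^-1 / s.
  rewrite -invfM /delta /s powRN -powRD; first by congr (_ `^ _)^-1; field.
  by rewrite (gt_eqF N0) implybT.
have si0 : 0 < s^-1 by rewrite invr_gt0.
have si2 : s^-1 <= 2^-1 by rewrite lef_pV2 ?posrE// ltW.
have delta0 : 0 <= delta by exact: powR_ge0.
(* Both have the denominator $s = n^{\beta/2}$, and the numerators satisfy $s^{-1} \le 2 \le
   2\ln(en)$. *)
have deltaq : delta <= q.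
  by rewrite deltaE /q ler_pM2r//; lra.
have delta2 : delta <= 1 / 2 by rewrite deltaE; nra.
have Vd l := beta_normal_coherence VN l.
(* $(1-\delta)\|c\|^2 \le \|Vc\|^2 = \|b\|^2 = 1$ with $\delta \le 1/2$. *)
have c2 : norm2 (invmx V *m x) ^+ 2 <= 2.
  have := norm2_near_orthonormal V1 Vd (invmx V *m x).
  rewrite mulKVmx// x1 expr1n -/N -/delta.
  by have := sqr_ge0 (norm2 (invmx V *m x)); nra.
(* The exponent 5 comes from $t^{-2} \le (32 n X)^2 = 32^2 \cdot n^2 \cdot X^2 \le X^2 \cdot X \cdot
   X^2$ and $X \le e^L$. *)
have ck l : expR (- (5 * L)) <= cabs ((invmx V *m x) l 0) ^+ 2.
  apply: (@le_trans _ _ (t ^+ 2)).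
    rewrite expRN /t exprVn lef_pV2 ?posrE ?expR_gt0 ?exprn_gt0 ?mulr_gt0//.
    have -> : expR (5 * L) = expR L ^+ 5 by rewrite -expRM_natl.
    apply: (@le_trans _ _ (X ^+ 5)); last first.
      by apply: lerXn2r; rewrite ?nnegrE ?expR_ge0// ltW.
    rewrite (@le_trans _ _ ((16 * N * (2 * X)) ^+ 2))//.
      apply: lerXn2r; rewrite ?nnegrE ?mulr_ge0 ?(ltW N0) ?(ltW X0)//.
      by rewrite ler_wpM2l// mulr_ge0// ltW.
    have X32 : 32 <= X by rewrite (le_trans _ XN2)//; nra.
    have -> : (16 * N * (2 * X)) ^+ 2 = 32 ^+ 2 * (N ^+ 2 * X ^+ 2) by ring.
    have -> : X ^+ 5 = X ^+ 2 * (X * X ^+ 2) by ring.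
    have X0' := ltW X0.
    apply: ler_pM; rewrite ?mulr_ge0 ?sqr_ge0//.
      by apply: lerXn2r; rewrite ?nnegrE.
    by rewrite ler_wpM2r ?sqr_ge0.
  rewrite (le_trans (xw l))// -cdot_dual /w1 cdotZl conjC_real cabsM exprMn.
  rewrite cabs_real ger0_norm ?invr_ge0 ?norm2_ge0//.
  rewrite ler_piMl ?sqr_ge0// expr_le1 ?invr_ge0 ?norm2_ge0//.
  by rewrite invf_le1 ?wge// (lt_le_trans ltr01).
rewrite -/N -/X -/L -/s -/q; set bnd := (_ + q) / (1 - q).
(* The angle lies in $[0, \pi/2)$, where the tangent is nonnegative. *)
have tan0 : 0 <= pi / N `^ gamma * tan (2 * pi / N `^ gamma).
  have N20 : 0 <= N `^ gamma by exact: powR_ge0.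
  have a0 : 0 <= 2 * pi / N `^ gamma by rewrite divr_ge0// mulr_ge0// pi_ge0.
  rewrite mulr_ge0 ?divr_ge0 ?pi_ge0//.
    by apply: sin_ge0_pi; rewrite a0 /= (le_trans (ltW gpi))//; have := pi_ge0 R; lra.
  by apply: cos_ge0_pihalf; rewrite (ltW gpi) andbT; have := pi_ge0 R; lra.
rewrite (@le_trans _ _ bnd)//; last by rewrite lerDl.
have eta0 : 0 <= 6 / m%:R * L by apply: mulr_ge0; [exact: divr_ge0|lra].
have q1' : 0 < 1 - q by rewrite subr_gt0.
have bnd0 : 0 <= bnd by apply: divr_ge0; [apply: addr_ge0 => //; lra|exact: ltW].
set K := convex_hull _.
(* For diameter 0 the quotient is 0 by the convention $0^{-1} = 0$. *)
have [D0|D0] := leP (diam K) 0.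
  have /eqP -> : diam K == 0 by rewrite eq_le D0 diam_ge0.
  by rewrite invr0 mulr0.
rewrite ler_pdivrMr//.
have delta01 : 0 <= delta < 1 by rewrite delta0; lra.
have delta1' : 0 < 1 - delta by lra.
apply: le_trans (one_sided_hausdorff_krylov k0 m0 L3 mL V1 Vd delta01 Vu AE c2 ck D0 Qb) _.
(* The expression $(\eta+\delta)/(1-\delta)$ increases with [delta], which is at most [q]. *)
rewrite ler_pM2r//; apply: ler_pM.
- exact: addr_ge0.
- by rewrite invr_ge0 ltW.
- by rewrite lerD2l.
- by rewrite lef_pV2 ?posrE// lerD2l lerN2.
Qed.
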